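(* Let $d\in\mathbb N$, let $I$ be an index set and let $(\mathcal R,+,\cdot)$ be a ring. Then the product $\circledast$ of Lions forests, its unit $\mathbf 1$, the coupled coproduct $\Delta$ and the counit $\epsilon$ on $\operatorname{span}_{\mathcal R}(\mathcal F_{0,d}[I])$ satisfy $$\Delta\circ\circledast=(\circledast\,\tilde\otimes\,\circledast)\circ\overline{\mathrm{Twist}}\circ(\Delta\otimes\Delta),$$ $$\epsilon\circ\circledast={\cdot}\circ(\epsilon\otimes\epsilon),\qquad \Delta\circ\mathbf 1\circ{\cdot}=\mathbf 1\otimes\mathbf 1,\qquad \epsilon\circ\mathbf 1=\mathrm{id}_{\mathcal R}.$$
   Context: Directed forests. A directed forest $(\mathcal N,E)$ is a finite acyclic directed graph each of whose components is a tree with all edges pointing towards its root (each non-root $x$ has exactly one parent $y$, $(x,y)\in E$). Depth = number of edges to the root; $x<y$ means depth$(x)<$depth$(y)$, $x\lesseqqgtr y$ means equal depths. Lions forests. For an index set $J$, $\mathcal F_{0,d}[J]$ is the set of tuples $T=(\mathcal N,E,h_J,H,\mathcal L)$, up to isomorphism, where $(\mathcal N,E)$ is a directed forest, $\mathcal L:\mathcal N\to\{1,\dots,d\}$, $h_J=(h_\iota)_{\iota\in J}$ are mutually disjoint, possibly empty subsets of $\mathcal N$, $H$ is a partition of $\mathcal N\setminus\bigcup_\iota h_\iota$ into non-empty blocks, and with $H'=(H\cup\{h_\iota\}_{\iota\in J})\setminus\{\emptyset\}$: (1) $h\in H'$, $x,y\in h$, $x<y$ imply there is $z\in h$ with $(y,z)\in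 E$; (2) $h\in H'$, $x_1,y_1\in h$, $x_1\lesseqqgtr y_1$, $(x_1,x_2),(y_1,y_2)\in E$, $x_2\neq y_2$ imply $x_2,y_2\in h$; (3) each non-empty $h_\iota$ contains a root. $\mathbf 1$ is the empty forest. The product $\circledast$ takes disjoint unions of nodes, edges and labels, $h_\iota=h^1_\iota\cup h^2_\iota$, $H=H^1\cup H^2$; it is extended linearly to $\operatorname{span}_{\mathcal R}(\mathcal F_{0,d}[J]\times\mathcal F_{0,d}[J])$, identified with the tensor square of $\operatorname{span}_{\mathcal R}(\mathcal F_{0,d}[J])$ ($\operatorname{span}_{\mathcal R}(S)$ is the free $\mathcal R$-module on $S$). Coupled pairs. For $Y\in\mathcal F_{0,d}[I]$ put $\mathcal F_{0,d}[Y]=\mathcal F_{0,d}[I\sqcup H^Y]$ (hyperedges of $Y$ serve as extra tags). $\mathcal F_{0,d}\tilde\times\mathcal F_{0,d}[I]$ is the set of pairs $(\Upsilon,Y)$ with $Y\in\mathcal F_{0,d}[I]$, $\Upsilon\in\mathcal F_{0,d}[Y]$, up to simultaneous isomorphism. Cuts. An admissible cut of a non-empty tree is a non-empty $c\subseteq E$ such that the path from any node to the root contains at most one edge of $c$, or one of two formal empty cuts $(\emptyset,+),(\emptyset,-)$. $\mathcal N_c^R$ is the set of nodes whose path to the root contains no edge of $c$; $\mathcal N^R_{(\emptyset,+)}=\mathcal N$, $\mathcal N^R_{(\emptyset,-)}=\emptyset$. For a forest, $C(T)$ is the product of the sets of cuts of its component trees ($C(\mathbf 1)$ is a singleton) and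 $\mathcal N_c^R$ is the union over components. Put $\mathcal N_c^P=\mathcal N\setminus\mathcal N_c^R$. Root: $T_c^R\in\mathcal F_{0,d}[I]$ has nodes $\mathcal N_c^R$, restricted edges and labels, tagged hyperedges $h_\iota\cap\mathcal N_c^R$ and hyperedges $H_c^R=\{h\cap\mathcal N_c^R:h\in H\}\setminus\{\emptyset\}$. Prune: $T_c^P\in\mathcal F_{0,d}[I\sqcup H_c^R]$ has nodes $\mathcal N_c^P$, restricted edges and labels, tagged hyperedges $h_\iota\cap\mathcal N_c^P$ for $\iota\in I$ and $h\cap\mathcal N_c^P$ for the tag $g=h\cap\mathcal N_c^R\in H_c^R$ ($h\in H$), and hyperedges $H_c^P=\{h\in H:h\cap\mathcal N_c^R=\emptyset\}$. Coproduct and counit. $\Delta:\operatorname{span}_{\mathcal R}(\mathcal F_{0,d}[I])\to\operatorname{span}_{\mathcal R}(\mathcal F_{0,d}\tilde\times\mathcal F_{0,d}[I])$ is linear with $\Delta[T]=\sum_{c\in C(T)}(T_c^P,T_c^R)$, $\Delta[\mathbf 1]=(\mathbf 1,\mathbf 1)$. $\epsilon$ is linear with $\epsilon(\mathbf 1)=1_{\mathcal R}$ and $\epsilon(T)=0$ for $T\ne\mathbf 1$. Also $\mathbf 1:\mathcal R\to\operatorname{span}_{\mathcal R}(\mathcal F_{0,d}[I])$ denotes $r\mapsto r\mathbf 1$, $\cdot$ is the multiplication of $\mathcal R$, and $\mathbf 1\otimes\mathbf 1$ sends $r\otimes s$ to $rs(\mathbf 1,\mathbf 1)$. Twist. $\overline{\mathrm{Twist}}$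 is the linear map sending $\big((\Upsilon_1,Y_1),(\Upsilon_2,Y_2)\big)$ to $\big((\Upsilon_1,\Upsilon_2),(Y_1,Y_2)\big)$, where each $\Upsilon_i$ is viewed in $\mathcal F_{0,d}[I\sqcup H^{Y_1}\sqcup H^{Y_2}]$ by leaving the additional tags empty. For $Y_i\in\mathcal F_{0,d}[I]$ and $\Upsilon_i\in\mathcal F_{0,d}[I\sqcup H^{Y_1}\sqcup H^{Y_2}]$, $(\circledast\tilde\otimes\circledast)\big((\Upsilon_1,\Upsilon_2),(Y_1,Y_2)\big)=(\Upsilon_1\circledast\Upsilon_2,Y_1\circledast Y_2)$, using $H^{Y_1\circledast Y_2}=H^{Y_1}\sqcup H^{Y_2}$, extended linearly. $\Delta\otimes\Delta$ is the linear map sending $(T_1,T_2)$ to the product of $\Delta[T_1]$ and $\Delta[T_2]$. *)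

(* Defs.v *)
From HB Require Import structures.
From mathcomp Require Import all_boot all_order all_algebra.
From mathcomp Require Import generic_quotient finmap monalg boolp.

Set Implicit Arguments.
Unset Strict Implicit.
Unset Printing Implicit Defensive.

Import GRing.Theory.
Local Open Scope quotient_scope.
Local Open Scope ring_scope.

(* ------------------------------------------------------------------------ *)
(* Free modules. [fspan R S] is the finitely supported functions S -> R; it   *)
(* is a copy of [{malg R[S]}], whose own module structure requires 1 != 0.   *)

Definition fspan (R : pzRingType) (S : choiceType) := {malg R[S]}.

Section Span.
Variables (R : pzRingType) (S : choiceType).
Implicit Types (u v : fspan R S) (a b : R).

HB.instance Definition _ := Choice.on (fspan R S).
HB.instance Definition _ := GRing.Zmodule.on (fspan R S).

Definition span_scale a u : fspan R S := [malg k in msupp u => a * u@_k].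

Lemma span_scaleE a u s : (span_scale a u)@_s = a * u@_s.
Proof.
rewrite /span_scale mcoeffE; case: ifPn => // /mcoeff_outdom ->.
by rewrite mulr0.
Qed.

Fact span_scaleA a b u : span_scale a (span_scale b u) = span_scale (a * b) u.
Proof. by apply/malgP=> s; rewrite !span_scaleE mulrA. Qed.

Fact span_scale1 : left_id 1 span_scale.
Proof. by move=> u; apply/malgP=> s; rewrite span_scaleE mul1r. Qed.

Fact span_scaleDr : right_distributive span_scale +%R.
Proof.
by move=> a u v; apply/malgP=> s; rewrite !(mcoeffD, span_scaleE) mulrDr.
Qed.

Fact span_scaleDl u : {morph span_scale^~ u : a b / a + b}.
Proof.
by move=> a b; apply/malgP=> s; rewrite !(mcoeffD, span_scaleE) mulrDl.
Qed.

HB.instance Definition _ := GRing.Zmodule_isLmodule.Build R (fspan R S)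
  span_scaleA span_scale1 span_scaleDr span_scaleDl.

Definition gen (s : S) : fspan R S := mkmalgU s 1.

Definition lin (M : lmodType R) (f : S -> M) (u : fspan R S) : M :=
  \sum_(s <- msupp u) u@_s *: f s.

End Span.

Arguments gen {R S} s.

(* Tensor products of free modules are identified with free modules on       *)
(* products of the generating sets.                                          *)
Definition tensor (R : pzRingType) (S1 S2 : choiceType)
    (u : fspan R S1) (v : fspan R S2) : fspan R (S1 * S2)%type :=
  lin (fun s1 => lin (fun s2 => gen (s1, s2)) v) u.

(* The composite of the tensor product of f1 and f2 with the linear map      *)
(* induced by the bilinear map b.                                            *)
Definition lin2 (R : pzRingType) (S1 S2 : choiceType) (M1 M2 M : lmodType R)
    (b : M1 -> M2 -> M) (f1 : fspan R S1 -> M1) (f2 : fspan R S2 -> M2) :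
    fspan R (S1 * S2)%type -> M :=
  lin (fun s => b (f1 (gen s.1)) (f2 (gen s.2))).

(* ------------------------------------------------------------------------ *)
(* Directed forests. An edge (x, y) goes from the child x to its parent y.   *)

Section DirectedForest.
Variables (N : finType).
Implicit Types (E : {set N * N}) (x y z r : N).

Definition edge_rel E : rel N := fun x y => (x, y) \in E.

Definition is_root E x := [forall y, (x, y) \notin E].

Record directed_forest E : Prop := DirectedForest {
  forest_acyclic :
    forall x p, path (edge_rel E) x p -> last x p = x -> p = [::];
  forest_parent : forall x, ~~ is_root E x -> #|[set y | (x, y) \in E]| = 1%N }.

(* In a directed forest the edges of the path from x to its root are exactly *)
(* those whose source can be reached from x (see path_edgesE).               *)
Definition path_edges E x := [set e in E | connect (edge_rel E) x e.1].

Definition depth E x := #|path_edges E x|.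

Lemma forest_parent_uniq E x y z :
  directed_forest E -> (x, y) \in E -> (x, z) \in E -> y = z.
Proof.
move=> fE xy xz; have nr : ~~ is_root E x.
  by rewrite negb_forall; apply/existsP; exists y; rewrite negbK.
have /eqP/cards1P[t tE] := forest_parent fE nr.
have : y \in [set t] by rewrite -tE inE.
have : z \in [set t] by rewrite -tE inE.
by move=> /set1P-> /set1P->.
Qed.

Lemma rootPn E x : reflect (exists y, (x, y) \in E) (~~ is_root E x).
Proof.
rewrite negb_forall; apply: (iffP existsP) => -[y]; first by rewrite negbK; exists y.
by move=> xy; exists y; rewrite negbK.
Qed.

Lemma depth_root E x : is_root E x -> depth E x = 0%N.
Proof.
move=> /forallP rx; apply/eqP; rewrite cards_eq0; apply/eqP/setP=> -[a b].
rewrite !inE /=; apply/negP=> /andP[ab /connectP[p pp la]].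
case: p pp la => [_ /= ax|y p /= /andP[xy _] _].

  by move: (rx b); rewrite -ax ab.
by move: (rx y); rewrite -[_ \in _]/(edge_rel E x y) xy.
Qed.

Lemma forest_no_back E x y :
  directed_forest E -> (x, y) \in E -> ~~ connect (edge_rel E) y x.
Proof.
move=> fE xy; apply/negP=> /connectP[p pp lp].
by have /(_ x (y :: p)) := forest_acyclic fE; rewrite /= [edge_rel _ _ _]xy;
  move/(_ pp (esym lp)).
Qed.

Lemma path_edges_step E x y : directed_forest E -> (x, y) \in E ->
  path_edges E x = (x, y) |: path_edges E y.
Proof.
move=> fE xy; apply/setP=> -[a b]; rewrite !inE /=.
apply/idP/idP.
  case/andP=> ab /connectP[[|z p] /= pp la].
    by rewrite xpair_eqE la eqxx /= (forest_parent_uniq fE xy (z := b)) ?eqxx // -la.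
  case/andP: pp => xz pp; apply/orP; right; rewrite ab /=; apply/connectP.
  by exists p; rewrite (forest_parent_uniq fE xy xz).
case/orP=> [/eqP[-> ->]|/andP[-> ya]]; first by rewrite xy connect0.
by apply: connect_trans ya; apply: connect1.
Qed.

Lemma depth_step E x y : directed_forest E -> (x, y) \in E ->
  depth E x = (depth E y).+1.
Proof.
move=> fE xy; rewrite /depth (path_edges_step fE xy) cardsU1 inE /=.
by rewrite (negPf (forest_no_back fE xy)) andbF.
Qed.

Lemma up_ind E (P : N -> Prop) : directed_forest E ->
  (forall x, (forall y, (x, y) \in E -> P y) -> P x) -> forall x, P x.
Proof.
move=> fE IH x; have [n] := ubnP (depth E x); elim: n x => // n IHn x.
by move=> dx; apply: IH => y xy; apply: IHn; rewrite (depth_step fE xy) in dx.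
Qed.

Lemma forest_root E x : directed_forest E ->
  exists2 r, is_root E r & connect (edge_rel E) x r.
Proof.
move=> fE; move: x; apply: (up_ind fE) => x IH.
have [rx|/rootPn[y xy]] := boolP (is_root E x); first by exists x.
have [r rr yr] := IH y xy; exists r => //.
by apply: connect_trans yr; apply: connect1.
Qed.

Lemma forest_root_uniq E x r s : directed_forest E ->
  is_root E r -> is_root E s ->
  connect (edge_rel E) x r -> connect (edge_rel E) x s -> r = s.
Proof.
move=> fE rr rs.
have stop : forall t u, is_root E t -> connect (edge_rel E) t u -> t = u.
  move=> t u /forallP rt /connectP[[|v p] /= pp lp]; first by rewrite lp.
  by case/andP: pp; rewrite /edge_rel (negPf (rt v)).
move: x; apply: (up_ind fE) => x IH xr xs.
have [rx|/rootPn[y xy]] := boolP (is_root E x).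
  by rewrite -(stop x r) // -(stop x s).
have par : forall t, is_root E t -> connect (edge_rel E) x t -> connect (edge_rel E) y t.
  move=> t rt /connectP[[|v p] /= pp lp].
    by move/forallP: rt => /(_ y); rewrite lp xy.
  case/andP: pp => xv pp; apply/connectP; exists p => //.
    by rewrite (forest_parent_uniq fE xy xv).
  by rewrite (forest_parent_uniq fE xy xv).
by apply: (IH y) => //; apply: par.
Qed.

Lemma path_edgesE E x p : directed_forest E ->
  path (edge_rel E) x p -> is_root E (last x p) ->
  path_edges E x = [set e in zip (x :: p) p] /\ depth E x = size p.
Proof.
move=> fE; elim: p x => [|y p IH] x /=.
  move=> _ rx; split; last exact: depth_root.
  have /eqP := depth_root rx; rewrite cards_eq0 => /eqP->.
  by apply/setP=> e; rewrite !inE.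
case/andP=> xy pp rl; have [pE dE] := IH y pp rl.
split; last by rewrite (depth_step fE xy) dE.
by rewrite (path_edges_step fE xy) pE; apply/setP=> e; rewrite !inE.
Qed.

End DirectedForest.

(* ------------------------------------------------------------------------ *)
(* Lions forests on a fixed node set N, with labels in 'I_d and tags in J.   *)

Record lions_data (d : nat) (N : finType) (J : Type) := LionsData {
  edges : {set N * N};
  lab : N -> 'I_d;
  tags : J -> {set N};
  hedges : {set {set N}} }.

Section LionsAxioms.
Variables (d : nat) (N : finType) (J : Type) (T : lions_data d N J).

Definition untagged : {set N} := [set x | `[< forall j, x \notin tags T j >]].

Definition hyper (h : {set N}) : Prop :=
  h != set0 /\ (h \in hedges T \/ exists j, h = tags T j).

Record lions_axioms : Prop := LionsAxioms {
  lions_forest : directed_forest (edges T);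
  lions_disjoint : forall j k, j <> k -> [disjoint tags T j & tags T k];
  lions_partition : partition (hedges T) untagged;
  lions_cond1 : forall h x y, hyper h -> x \in h -> y \in h ->
    (depth (edges T) x < depth (edges T) y)%N ->
    exists2 z, z \in h & (y, z) \in edges T;
  lions_cond2 : forall h x1 y1 x2 y2, hyper h -> x1 \in h -> y1 \in h ->
    depth (edges T) x1 = depth (edges T) y1 ->
    (x1, x2) \in edges T -> (y1, y2) \in edges T -> x2 <> y2 ->
    x2 \in h /\ y2 \in h;
  lions_cond3 : forall j, tags T j != set0 ->
    exists2 x, x \in tags T j & is_root (edges T) x }.

End LionsAxioms.

Record lforest (d : nat) (N : finType) (J : Type) := LForest {
  ldata :> lions_data d N J;
  laxioms : lions_axioms ldata }.

Section LionsTheory.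
Variables (d : nat) (N : finType) (J : Type).
Implicit Types (T : lions_data d N J).

Lemma partition_P (P : {set {set N}}) (D : {set N}) :
  set0 \notin P ->
  (forall h k x, h \in P -> k \in P -> x \in h -> x \in k -> h = k) ->
  (forall x, x \in D <-> exists2 h, h \in P & x \in h) ->
  partition P D.
Proof.
move=> P0 dP cP; apply/and3P; split=> //.
  apply/eqP/setP=> x; apply/idP/idP.
    by case/bigcupP=> h hP xh; apply/cP; exists h.
  by case/cP=> h hP xh; apply/bigcupP; exists h.
apply/trivIsetP=> h k hP kP; apply: contraR; rewrite -setI_eq0.
by case/set0Pn=> x /setIP[xh xk]; apply/eqP; apply: dP xh xk.
Qed.

Lemma untaggedP T x : reflect (forall j, x \notin tags T j) (x \in untagged T).
Proof. by rewrite inE; apply: asboolP. Qed.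

Lemma hedges_cover T x : lions_axioms T ->
  x \in untagged T <-> exists2 h, h \in hedges T & x \in h.
Proof.
move=> aT; rewrite -(cover_partition (lions_partition aT)).
by split=> [/bigcupP[h]|[h hT xh]]; [exists h | apply/bigcupP; exists h].
Qed.

Lemma hedges_neq0 T h : lions_axioms T -> h \in hedges T -> h != set0.
Proof.
move=> aT hT; apply/eqP=> h0; have /and3P[_ _] := lions_partition aT.
by rewrite -h0 hT.
Qed.

Lemma hedges_inj T h k x : lions_axioms T ->
  h \in hedges T -> k \in hedges T -> x \in h -> x \in k -> h = k.
Proof.
move=> aT hT kT xh xk; have /and3P[_ /trivIsetP tI _] := lions_partition aT.
apply/eqP; apply: contraT => /(tI _ _ hT kT); rewrite -setI_eq0 => /eqP/setP/(_ x).
by rewrite !inE xh xk.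
Qed.

Lemma tags_inj T j k x : lions_axioms T -> x \in tags T j -> x \in tags T k -> j = k.
Proof.
move=> aT xj xk; apply: contrapT => /(lions_disjoint aT).
by rewrite -setI_eq0 => /eqP/setP/(_ x); rewrite !inE xj xk.
Qed.

Lemma hyper_hedge T h : lions_axioms T -> h \in hedges T -> hyper T h.
Proof. by move=> aT hT; split; [apply: hedges_neq0 hT | left]. Qed.

Lemma tags_up T j x y : lions_axioms T ->
  x \in tags T j -> (x, y) \in edges T -> y \in tags T j.
Proof.
move=> aT xj xy; have fT := lions_forest aT.
have jn0 : tags T j != set0 by apply/set0Pn; exists x.
have [r rj rr] := lions_cond3 aT jn0.
have [] := @lions_cond1 _ _ _ _ aT (tags T j) r x _ rj xj.
- by split=> //; right; exists j.
- by rewrite (depth_root rr) (depth_step fT xy).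
by move=> z zj xz; rewrite (forest_parent_uniq fT xy xz).
Qed.

(* Conditions (1)-(3) on a tagged hyperedge say that it is closed under      *)
(* taking parents.                                                           *)
Lemma mk_lions_axioms T :
  directed_forest (edges T) ->
  (forall j k x, x \in tags T j -> x \in tags T k -> j = k) ->
  set0 \notin hedges T ->
  (forall h k x, h \in hedges T -> k \in hedges T -> x \in h -> x \in k -> h = k) ->
  (forall x, (forall j, x \notin tags T j) <-> exists2 h, h \in hedges T & x \in h) ->
  (forall j x y, x \in tags T j -> (x, y) \in edges T -> y \in tags T j) ->
  (forall h x y, h \in hedges T -> x \in h -> y \in h ->
    (depth (edges T) x < depth (edges T) y)%N ->
    exists2 z, z \in h & (y, z) \in edges T) ->
  (forall h x1 y1 x2 y2, h \in hedges T -> x1 \in h -> y1 \in h ->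
    depth (edges T) x1 = depth (edges T) y1 ->
    (x1, x2) \in edges T -> (y1, y2) \in edges T -> x2 <> y2 ->
    x2 \in h /\ y2 \in h) ->
  lions_axioms T.
Proof.
move=> fT dT T0 hT cT up c1 c2; split=> //.
- move=> j k jk; rewrite -setI_eq0; apply: contra_notT jk.
  by case/set0Pn=> x /setIP[xj xk]; apply: dT xj xk.
- by apply: partition_P => // x; rewrite -cT; split=> /untaggedP.
- move=> h x y [_ [hh|[j ->]]]; first exact: c1.
  move=> _ yj xy; have [ry|/rootPn[z yz]] := boolP (is_root (edges T) y).
    by rewrite (depth_root ry) in xy.
  by exists z => //; apply: up yz.
- move=> h x1 y1 x2 y2 [_ [hh|[j ->]]]; first exact: c2.
  by move=> xj yj _ ex ey _; split; [apply: up ex | apply: up ey].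
- move=> j /set0Pn[x xj]; move: x xj; apply: (up_ind fT) => x IH xj.
  have [rx|/rootPn[y xy]] := boolP (is_root (edges T) x); first by exists x.
  by apply: (IH y) => //; apply: up xy.
Qed.

End LionsTheory.

Lemma directed_forest_rank (N : finType) (E : {set N * N}) (m : N -> nat) :
  (forall x y, (x, y) \in E -> (m y < m x)%N) ->
  (forall x y z, (x, y) \in E -> (x, z) \in E -> y = z) ->
  directed_forest E.
Proof.
move=> mE uE; split=> [x p|x /rootPn[y xy]]; last first.
  apply/eqP/cards1P; exists y; apply/setP=> z; rewrite !inE.
  by apply/idP/eqP=> [xz|->//]; apply: uE xz xy.
have le : forall p x, path (edge_rel E) x p -> (m (last x p) <= m x)%N.
  elim=> //= y q IH z /andP[zy /IH le]; apply: leq_trans le _.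
  exact: ltnW (mE _ _ zy).
case: p => //= y p /andP[xy /le ly] lx; move: (mE _ _ xy).
by rewrite ltnNge -lx ly.
Qed.

Lemma depth_embed (N N' : finType) (E : {set N * N}) (E' : {set N' * N'})
    (f : N' -> N) : directed_forest E -> directed_forest E' ->
  (forall x y, ((f x, f y) \in E) = ((x, y) \in E')) ->
  (forall x y, (f x, y) \in E -> exists y', y = f y') ->
  forall x, depth E (f x) = depth E' x.
Proof.
move=> fE fE' ff up; apply: (up_ind fE') => x IH.
have [rx|/rootPn[y xy]] := boolP (is_root E' x).
  rewrite (depth_root rx) depth_root //; apply/forallP=> y; apply/negP=> xy.
  have [y' yE] := up _ _ xy; move: xy; rewrite yE ff.
  by rewrite (negPf (forallP rx y')).
have fxy : (f x, f y) \in E by rewrite ff.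
by rewrite (depth_step fE' xy) (depth_step fE fxy) IH.
Qed.

(* ------------------------------------------------------------------------ *)
(* Inverse image along an injection of node sets. It is used to transport a  *)
(* forest along a bijection and to restrict it to a set of nodes closed      *)
(* under taking parents.                                                     *)

Section Pull.
Variables (d : nat) (N N' : finType) (J : Type) (T : lforest d N J).
Variables (f : N' -> N) (f_inj : injective f).
Variable (f_up : forall x y, (f x, y) \in edges T -> exists y', y = f y').

Definition pull_data : lions_data d N' J := LionsData
  [set e : N' * N' | (f e.1, f e.2) \in edges T]
  (fun x => lab T (f x))
  (fun j => f @^-1: tags T j)
  ([set f @^-1: (h : {set N}) | h in hedges T] :\ set0).

Lemma pull_axioms : lions_axioms pull_data.
Proof.
have aT := laxioms T; have fT := lions_forest aT.
have eE x y : ((x, y) \in edges pull_data) = ((f x, f y) \in edges T) by rewrite inE.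
have fP : directed_forest (edges pull_data).
  apply: (directed_forest_rank (m := fun x => depth (edges T) (f x))).
    by move=> x y; rewrite eE => xy; rewrite (depth_step fT xy).
  by move=> x y z; rewrite !eE => xy xz; apply: f_inj; apply: forest_parent_uniq xy xz.
have dE x : depth (edges T) (f x) = depth (edges pull_data) x.
  by apply: depth_embed => //; move=> y z; rewrite eE.
have hP h : h \in hedges pull_data -> exists2 k, k \in hedges T & h = f @^-1: k.
  by case/setD1P=> _ /imsetP[k kT ->]; exists k.
apply: mk_lions_axioms => //.
- by move=> j k x; rewrite !inE; apply: tags_inj.
- by rewrite !inE eqxx.
- move=> h k x /hP[h' h'T ->] /hP[k' k'T ->]; rewrite !inE => xh xk.
  by rewrite (hedges_inj aT h'T k'T xh xk).
- move=> x; split=> [nx|[h /hP[k kT ->]]].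
    have [cT _] := hedges_cover (f x) aT.
    case: cT => [|h hT xh]; first by apply/untaggedP=> j; move: (nx j); rewrite inE.
    exists (f @^-1: h); last by rewrite inE.
    apply/setD1P; split; last exact: imset_f.
    by apply/set0Pn; exists x; rewrite inE.
  rewrite inE => xk j; rewrite inE; have [_ cT] := hedges_cover (f x) aT.
  by move: j; apply/untaggedP/cT; exists k.
- by move=> j x y; rewrite eE !inE => xj; apply: tags_up.
- move=> h x y /hP[k kT ->]; rewrite !inE -!dE => xk yk lt.
  have [z zk yz] := lions_cond1 aT (hyper_hedge aT kT) xk yk lt.
  by have [z' zE] := f_up yz; exists z'; rewrite ?eE ?inE -zE.
- move=> h x1 y1 x2 y2 /hP[k kT ->]; rewrite !eE !inE -!dE => xk yk eq ex ey ne.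
  apply: (lions_cond2 aT (hyper_hedge aT kT) xk yk eq ex ey).
  by move/f_inj.
Qed.

Definition pull : lforest d N' J := LForest pull_axioms.

End Pull.

(* ------------------------------------------------------------------------ *)
(* Change of tags along f : J -> K, used for injective f only: the tag f j   *)
(* carries the hyperedge of j, and the tags outside the image of f are empty.*)

Section Push.
Variables (d : nat) (N : finType) (J K : Type) (f : J -> K).
Variable (T : lforest d N J).

Definition push_data : lions_data d N K := LionsData
  (edges T) (lab T)
  (fun k => [set x | `[< exists2 j, f j = k & x \in tags T j >]])
  (hedges T).

Lemma push_axioms : lions_axioms push_data.
Proof.
have aT := laxioms T; apply: mk_lions_axioms => /=.
- exact: lions_forest aT.
- move=> j k x; rewrite !inE => /asboolP[j' <- xj] /asboolP[k' <- xk].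
  by rewrite (tags_inj aT xj xk).
- by have /and3P[] := lions_partition aT.
- by move=> h k x; apply: hedges_inj.
- move=> x; rewrite -(hedges_cover x aT); split=> [nx|/untaggedP nx k].
    apply/untaggedP=> j; move: (nx (f j)); apply: contra => xj.
    by rewrite inE; apply/asboolP; exists j.
  by rewrite inE; apply/asboolP=> -[j _]; apply/negP/nx.
- move=> k x y; rewrite !inE => /asboolP[j <- xj] xy.
  by apply/asboolP; exists j => //; apply: tags_up xy.
- by move=> h x y hT; apply: (lions_cond1 aT); apply: hyper_hedge.
- by move=> h x1 y1 x2 y2 hT; apply: (lions_cond2 aT); apply: hyper_hedge.
Qed.

Definition push : lforest d N K := LForest push_axioms.

End Push.

(* ------------------------------------------------------------------------ *)

Section EmptyForest.
Variables (d : nat) (J : Type).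

Definition empty_data : lions_data d void J :=
  LionsData set0 (of_void _) (fun=> set0) set0.

Lemma empty_axioms : lions_axioms empty_data.
Proof.
apply: mk_lions_axioms => //=.
by rewrite inE.
Qed.

Definition empty_forest : lforest d void J := LForest empty_axioms.

End EmptyForest.

(* ------------------------------------------------------------------------ *)

Section Product.
Variables (d : nat) (N1 N2 : finType) (J : Type).
Variables (T1 : lforest d N1 J) (T2 : lforest d N2 J).

Definition product_edges : {set (N1 + N2) * (N1 + N2)} :=
  [set e | match e with
           | (inl x, inl y) => (x, y) \in edges T1
           | (inr x, inr y) => (x, y) \in edges T2
           | _ => false
           end].

Definition product_data : lions_data d (N1 + N2)%type J := LionsData
  product_edges
  (fun x => match x with inl x1 => lab T1 x1 | inr x2 => lab T2 x2 end)
  (fun j => inl @: tags T1 j :|: inr @: tags T2 j)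
  ([set inl @: (h : {set N1}) | h in hedges T1]
   :|: [set inr @: (h : {set N2}) | h in hedges T2]).

Lemma product_axioms : lions_axioms product_data.
Proof.
have aT1 := laxioms T1; have aT2 := laxioms T2.
have fT1 := lions_forest aT1; have fT2 := lions_forest aT2.
have inl_inj : injective (@inl N1 N2) by move=> x y [].
have inr_inj : injective (@inr N1 N2) by move=> x y [].
have lr (A : {set N1}) x : (inr x : N1 + N2) \in inl @: A = false.
  by apply/negP=> /imsetP[].
have rl (A : {set N2}) x : (inl x : N1 + N2) \in inr @: A = false.
  by apply/negP=> /imsetP[].
have ll (A : {set N1}) x : ((inl x : N1 + N2) \in inl @: A) = (x \in A).
  exact: mem_imset.
have rr (A : {set N2}) x : ((inr x : N1 + N2) \in inr @: A) = (x \in A).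
  exact: mem_imset.
have fP : directed_forest product_edges.
  apply: (directed_forest_rank (m := fun x => match x with
     inl x1 => depth (edges T1) x1 | inr x2 => depth (edges T2) x2 end)).
    by move=> [x|x] [y|y]; rewrite inE // => xy;
      rewrite ?(depth_step fT1 xy) ?(depth_step fT2 xy).
  move=> [x|x] [y|y] [z|z]; rewrite !inE // => xy xz; congr (_ _).
    exact: forest_parent_uniq xy xz.
  exact: forest_parent_uniq xy xz.
have d1 x : depth product_edges (inl x) = depth (edges T1) x.
  apply: depth_embed => //; first by move=> y z; rewrite inE.
  by move=> y [z|z]; rewrite inE // => _; exists z.
have d2 x : depth product_edges (inr x) = depth (edges T2) x.
  apply: depth_embed => //; first by move=> y z; rewrite inE.
  by move=> y [z|z]; rewrite inE // => _; exists z.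
apply: mk_lions_axioms => //=.
- by move=> j k [x|x]; rewrite !inE ?ll ?rr ?lr ?rl ?orbF /=; apply: tags_inj.
- apply/negP; rewrite inE => /orP[] /imsetP[h hT /esym/eqP].
    by rewrite imset_eq0 (negPf (hedges_neq0 aT1 hT)).
  by rewrite imset_eq0 (negPf (hedges_neq0 aT2 hT)).
- move=> h k [x|x] /setUP[] /imsetP[h' hT ->] /setUP[] /imsetP[k' kT ->];
    rewrite ?ll ?rr ?lr ?rl // => xh xk; congr imset.
    by rewrite (hedges_inj aT1 hT kT xh xk).
  by rewrite (hedges_inj aT2 hT kT xh xk).
- move=> [x|x].
    split=> [nx|[h /setUP[] /imsetP[h' hT ->]]]; rewrite ?ll ?rl //; last first.
      move=> xh j; rewrite inE ll rl orbF; have [_ cT] := hedges_cover x aT1.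
      by move: j; apply/untaggedP/cT; exists h'.
    have [cT _] := hedges_cover x aT1.
    case: cT => [|h hT xh].
      by apply/untaggedP=> j; move: (nx j); rewrite inE ll rl orbF.
    by exists (inl @: h); rewrite ?ll // inE imset_f.
  split=> [nx|[h /setUP[] /imsetP[h' hT ->]]]; rewrite ?rr ?lr //; last first.
    move=> xh j; rewrite inE rr lr; have [_ cT] := hedges_cover x aT2.
    by move: j; apply/untaggedP/cT; exists h'.
  have [cT _] := hedges_cover x aT2.
  case: cT => [|h hT xh].
    by apply/untaggedP=> j; move: (nx j); rewrite inE rr lr.
  by exists (inr @: h); rewrite ?rr // inE imset_f ?orbT.
- move=> j [x|x] [y|y]; rewrite !inE ?ll ?rr ?lr ?rl ?orbF //=; exact: tags_up.
- move=> h [x|x] [y|y] /setUP[] /imsetP[h' hT ->];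
    rewrite ?ll ?rr ?lr ?rl ?d1 ?d2 // => xh yh lt.
    have [z zh yz] := lions_cond1 aT1 (hyper_hedge aT1 hT) xh yh lt.
    by exists (inl z); rewrite ?ll ?inE.
  have [z zh yz] := lions_cond1 aT2 (hyper_hedge aT2 hT) xh yh lt.
  by exists (inr z); rewrite ?rr ?inE.
- move=> h [x1|x1] [y1|y1] [x2|x2] [y2|y2] /setUP[] /imsetP[h' hT ->];
    rewrite ?ll ?rr ?lr ?rl ?d1 ?d2 ?inE // => xh yh eq ex ey ne.
    apply: (lions_cond2 aT1 (hyper_hedge aT1 hT) xh yh eq ex ey).
    by move=> e; apply: ne; rewrite e.
  apply: (lions_cond2 aT2 (hyper_hedge aT2 hT) xh yh eq ex ey).
  by move=> e; apply: ne; rewrite e.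
Qed.

Definition product : lforest d (N1 + N2)%type J := LForest product_axioms.

End Product.

(* ------------------------------------------------------------------------ *)
(* Cuts. The type [hedge Y] provides the extra tags for a prune. The trees   *)
(* of a forest are indexed by their roots.                                   *)

Definition hedge (d : nat) (N : finType) (J : Type) (Y : lions_data d N J) :=
  {h : {set N} | h \in hedges Y}.

Section Cuts.
Variables (d : nat) (N : finType) (J : Type) (T : lforest d N J).
Let E := edges T.

Definition root_of := {r : N | is_root E r}.

Definition tree_edges (r : N) : {set N * N} :=
  [set e in E | connect (edge_rel E) e.1 r].

(* inl s is the cut s, and inr true, inr false are the empty cuts with signs *)
(* + and -.                                                                  *)
Definition tree_cut := ({set N * N} + bool)%type.

Definition admissible (r : N) (c : tree_cut) : bool :=
  match c with
  | inl s => [&& s != set0, s \subset tree_edges r &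
      [forall (x | connect (edge_rel E) x r), #|s :&: path_edges E x| <= 1]]
  | inr _ => true
  end%N.

Definition cut :=
  {c : {ffun root_of -> tree_cut} | [forall r, admissible (val r) (c r)]}.

Variable c : cut.

Definition above_cut (x : N) (s : tree_cut) : bool :=
  match s with
  | inl s => [disjoint s & path_edges E x]
  | inr b => b
  end.

Definition root_nodes : {set N} :=
  [set x | [exists r : root_of,
     connect (edge_rel E) x (val r) && above_cut x (val c r)]].

Definition prune_nodes : {set N} := ~: root_nodes.

Lemma root_nodesP x r : is_root E (val r) -> connect (edge_rel E) x (val r) ->
  (x \in root_nodes) = above_cut x (val c r).
Proof.
have fT := lions_forest (laxioms T); move=> rr xr; rewrite inE.
apply/existsP/idP=> [[s /andP[xs]]|ok]; last by exists r; rewrite xr.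
by have -> // : s = r; apply/val_inj; apply: forest_root_uniq xs xr => //; apply: (valP s).
Qed.

Lemma root_nodes_up x y : (x, y) \in E -> x \in root_nodes -> y \in root_nodes.
Proof.
have fT := lions_forest (laxioms T); move=> xy.
have [r rr yr] := forest_root y fT.
have xr : connect (edge_rel E) x r by apply: connect_trans (connect1 _) yr.
rewrite (root_nodesP (r := exist _ r rr) rr xr) (root_nodesP (r := exist _ r rr) rr yr).
case: (val c _) => //= s; apply: disjointWr.
by rewrite (path_edges_step fT xy) subsetUr.
Qed.

Definition restr (D h : {set N}) : {set {x : N | x \in D}} := [set x | val x \in h].

Lemma root_val_up (x : {x : N | x \in root_nodes}) y :
  (val x, y) \in E -> exists y' : {x : N | x \in root_nodes}, y = val y'.
Proof. by move=> /root_nodes_up/(_ (valP x)) yR; exists (exist _ y yR). Qed.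

(* The nodes of [cut_root] are [root_nodes], the edges and labels are        *)
(* restricted, and the hyperedges are the intersections with [root_nodes].   *)
Definition cut_root : lforest d {x : N | x \in root_nodes} J :=
  pull val_inj root_val_up.

Definition prune_tags (t : (J + hedge cut_root)%type) :
    {set {x : N | x \in prune_nodes}} :=
  match t with
  | inl j => restr prune_nodes (tags T j)
  | inr g => \bigcup_(h in hedges T | restr root_nodes h == val g)
               restr prune_nodes h
  end.

Definition prune_data :
    lions_data d {x : N | x \in prune_nodes} (J + hedge cut_root) := LionsData
  [set e | (val e.1, val e.2) \in E]
  (fun x => lab T (val x))
  prune_tags
  [set restr prune_nodes h | h in [set h in hedges T | h :&: root_nodes == set0]].

Lemma prune_axioms : lions_axioms prune_data.
Proof.
have aT := laxioms T; have fT : directed_forest E := lions_forest aT.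
have eE x y : ((x, y) \in edges prune_data) = ((val x, val y) \in E) by rewrite inE.
have fP : directed_forest (edges prune_data).
  apply: (directed_forest_rank (m := fun x => depth E (val x))).
    by move=> x y; rewrite eE => xy; rewrite (depth_step fT xy).
  by move=> x y z; rewrite !eE => xy xz; apply: val_inj; apply: forest_parent_uniq xy xz.
have PR x : x \in prune_nodes -> x \notin root_nodes by rewrite inE.
have dpar (x y : {x : N | x \in prune_nodes}) (p : N) : (val x, p) \in E ->
    (val y, p) \in E -> p \in prune_nodes ->
    depth (edges prune_data) x = depth (edges prune_data) y.
  move=> xp yp pP; rewrite (depth_step fP (y := exist _ p pP)) ?eE //.
  by rewrite (depth_step fP (x := y) (y := exist _ p pP)) ?eE.
(* a hyperedge meeting the root nodes is closed under parents in the prune *)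
have up h r x y : h \in hedges T -> r \in h -> r \in root_nodes ->
    x \in h -> (x, y) \in E -> y \in prune_nodes -> y \in h.
  move=> hT; move: r; apply: (up_ind fT) => r IH rh rR xh xy yP.
  have hh := hyper_hedge aT hT.
  have [lt|le|eq] := ltngtP (depth E r) (depth E x).
  - have [z zh xz] := lions_cond1 aT hh rh xh lt.
    by rewrite (forest_parent_uniq fT xy xz).
  - have [z zh rz] := lions_cond1 aT hh xh rh le.
    exact: IH zh (root_nodes_up rz rR) xh xy yP.
  have [rr|/rootPn[z rz]] := boolP (is_root E r).
    by move: eq; rewrite (depth_root rr) (depth_step fT xy).
  have zR := root_nodes_up rz rR.
  have yz : z <> y by move=> zy; move: (PR _ yP); rewrite -zy zR.
  by have [] := lions_cond2 aT hh rh xh eq rz xy yz.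
have gP (g : hedge cut_root) : exists h r, [/\ h \in hedges T, r \in h,
    r \in root_nodes & forall k, (k \in hedges T) && (restr root_nodes k == val g) = (k == h)].
  have /setD1P[gn0 /imsetP[h hT gE]] := valP g.
  have /set0Pn[r rg] := gn0.
  have rh : val r \in h by move: rg; rewrite gE inE.
  exists h, (val r); split=> //; first exact: (valP r).
  move=> k; apply/andP/eqP=> [[kT /eqP kg]|->].
    have rk : val r \in k by move: rg; rewrite -kg inE.
    exact: hedges_inj aT kT hT rk rh.
  by split=> //; apply/eqP; rewrite gE; apply/setP=> z; rewrite !inE.
have tagP (g : hedge cut_root) : exists h r, [/\ h \in hedges T, r \in h,
    r \in root_nodes, restr root_nodes h = val g & tags prune_data (inr g) = restr prune_nodes h].
  have [h [r [hT rh rR hE]]] := gP g; exists h, r; split=> //.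
    by apply/eqP; have := hE h; rewrite eqxx hT.
  by rewrite /= (big_pred1 h).
have hP h : h \in hedges prune_data -> exists k, [/\ k \in hedges T,
    forall x, x \in k -> x \in prune_nodes & h = restr prune_nodes k].
  case/imsetP=> k; rewrite inE => /andP[kT /eqP k0] ->; exists k; split=> // x xk.
  by rewrite inE; apply/negP=> xR; move/setP/(_ x): k0; rewrite in_setI in_set0 xk xR.
apply: mk_lions_axioms => //.
- move=> [j|g] [k|l] x.
  + by rewrite !inE => xj xk; rewrite (tags_inj aT xj xk).
  + have [h [r [hT rh rR _ ->]]] := tagP l; rewrite !inE => xj xh.
    have [_ cT] := hedges_cover (val x) aT.
    have /untaggedP/(_ j) : val x \in untagged T by apply: cT; exists h.
    by rewrite xj.
  + have [h [r [hT rh rR _ ->]]] := tagP g; rewrite !inE => xh xj.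
    have [_ cT] := hedges_cover (val x) aT.
    have /untaggedP/(_ k) : val x \in untagged T by apply: cT; exists h.
    by rewrite xj.
  have [h [r [hT rh rR hg ->]]] := tagP g; have [k [s [kT sk sR kl ->]]] := tagP l.
  rewrite !inE => xh xk; congr inr; apply: val_inj.
  by rewrite -hg -kl (hedges_inj aT hT kT xh xk).
- apply/negP=> /hP[k [kT kP]] /setP k0.
  have /set0Pn[x xk] := hedges_neq0 aT kT.
  by have := k0 (exist _ x (kP x xk)); rewrite !inE /= xk.
- move=> h k x /hP[h' [hT _ ->]] /hP[k' [kT _ ->]]; rewrite !inE => xh xk.
  by rewrite (hedges_inj aT hT kT xh xk).
- move=> x; split=> [nx|[h /hP[k [kT kP ->]]]].
    have [cT _] := hedges_cover (val x) aT.
    case: cT => [|h hT xh].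
      by apply/untaggedP=> j; move: (nx (inl j)); rewrite inE.
    have [hR|] := eqVneq (h :&: root_nodes) set0.
      by exists (restr prune_nodes h); rewrite ?inE //; apply: imset_f; rewrite inE hT hR eqxx.
    case/set0Pn=> r /setIP[rh rR].
    have gh : restr root_nodes h \in hedges cut_root.
      apply/setD1P; split.
        by apply/set0Pn; exists (exist _ r rR); rewrite inE.
      by apply/imsetP; exists h => //; apply/setP=> z; rewrite !inE.
    have /negP[] := nx (inr (exist (fun h => h \in hedges cut_root) _ gh)).
    by apply/bigcupP; exists h; rewrite ?hT ?eqxx ?inE.
  rewrite inE => xk; have [_ cT] := hedges_cover (val x) aT.
  have ux : val x \in untagged T by apply: cT; exists k.
  move=> [j|g]; first by rewrite inE; move: j; apply/untaggedP.
  have [l [r [lT rl rR _ ->]]] := tagP g; rewrite inE; apply/negP=> xl.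
  have rk : r \in k by rewrite -(hedges_inj aT lT kT xl xk).
  by move: (PR _ (kP r rk)); rewrite rR.
- move=> [j|g] x y; rewrite eE; first by rewrite !inE; apply: tags_up.
  have [h [r [hT rh rR _ ->]]] := tagP g; rewrite !inE => xh xy.
  exact: up hT rh rR xh xy (valP y).
- move=> h x y /hP[k [kT kP ->]]; rewrite !inE => xk yk.
  have hh := hyper_hedge aT kT.
  have [ry|/rootPn[z]] := boolP (is_root (edges prune_data) y).
    by rewrite (depth_root ry).
  rewrite eE => yz lt.
  suff zk : val z \in k by exists z; rewrite ?inE // eE.
  have [xv xvE] : exists xv, xv = val x by exists (val x).
  move: xv x xk lt xvE; apply: (up_ind fT) => xv IH x xk lt xvE.
  have [lt'|gt|eq] := ltngtP (depth E (val x)) (depth E (val y)).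
  + have [w wk yw] := lions_cond1 aT hh xk yk lt'.
    by rewrite (forest_parent_uniq fT yz yw).
  + have [w wk xw] := lions_cond1 aT hh yk xk gt.
    apply: (IH w _ (exist _ w (kP w wk))) => //; first by rewrite xvE.
    apply: leq_ltn_trans lt.
    by rewrite (depth_step fP (x := x) (y := exist _ w (kP w wk))) // eE.
  have [rx|/rootPn[w xw]] := boolP (is_root E (val x)).
    by move: eq; rewrite (depth_root rx) (depth_step fT yz).
  have wz : w <> val z.
    move=> wz; rewrite wz in xw; move: lt.
    by rewrite (dpar x y (val z) xw yz (valP z)) ltnn.
  by have [] := lions_cond2 aT hh xk yk eq xw yz wz.
have key k (x1 y1 x2 : {x : N | x \in prune_nodes}) : k \in hedges T ->
    (forall x, x \in k -> x \in prune_nodes) -> val x1 \in k -> val y1 \in k ->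
    (depth (edges prune_data) y1 <= depth (edges prune_data) x1)%N ->
    (depth (edges prune_data) y1 = depth (edges prune_data) x1 ->
      (y1, x2) \notin edges prune_data) ->
    (x1, x2) \in edges prune_data -> val x2 \in k.
  move=> kT kP x1k y1k; rewrite !eE => le ne ex; have hh := hyper_hedge aT kT.
  have [yv yvE] : exists yv, yv = val y1 by exists (val y1).
  move: yv y1 y1k le ne yvE; apply: (up_ind fT) => yv IH y1 y1k le ne yvE.
  have [lt'|gt|eq] := ltngtP (depth E (val y1)) (depth E (val x1)).
  + have [w wk xw] := lions_cond1 aT hh y1k x1k lt'.
    by rewrite (forest_parent_uniq fT ex xw).
  + have [w wk yw] := lions_cond1 aT hh x1k y1k gt.
    have yw' : (y1, exist _ w (kP w wk)) \in edges prune_data by rewrite eE.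
    have lt := depth_step fP yw'; rewrite lt in le.
    apply: (IH w _ (exist _ w (kP w wk))) => //; first by rewrite yvE.
    - exact: ltnW.
    - by move=> e; move: le; rewrite e ltnn.
  have [ry|/rootPn[w yw]] := boolP (is_root E (val y1)).
    by move: eq; rewrite (depth_root ry) (depth_step fT ex).
  have wz : w <> val x2.
    move=> wz; rewrite wz in yw; have e := dpar y1 x1 (val x2) yw ex (valP x2).
    by have := ne e; rewrite yw.
  by have [] := lions_cond2 aT hh y1k x1k eq yw ex wz.
move=> h x1 y1 x2 y2 /hP[k [kT kP ->]]; rewrite !inE => x1k y1k eq ex ey ne.
split.
  apply: (key k x1 y1 x2); rewrite ?eq ?eE // => _; apply/negP=> ey'.
  by apply: ne; apply: val_inj; apply: forest_parent_uniq ey' ey.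
apply: (key k y1 x1 y2); rewrite ?eq ?eE // => _; apply/negP=> ex'.
by apply: ne; apply: val_inj; apply: forest_parent_uniq ex ex'.
Qed.

Definition cut_prune : lforest d {x : N | x \in prune_nodes} (J + hedge cut_root) :=
  LForest prune_axioms.

End Cuts.

(* ------------------------------------------------------------------------ *)
(* Isomorphisms. The relation m says which tags of T' correspond to which    *)
(* tags of T.                                                                *)

Definition lions_iso (d : nat) (N N' : finType) (J J' : Type)
    (m : J -> J' -> Prop) (T : lions_data d N J) (T' : lions_data d N' J')
    (phi : N -> N') : Prop :=
  [/\ bijective phi,
      forall x y, ((phi x, phi y) \in edges T') = ((x, y) \in edges T),
      forall x, lab T' (phi x) = lab T x,
      forall j j', m j j' -> tags T' j' = phi @: tags T j
    & hedges T' = [set phi @: (h : {set N}) | h in hedges T]].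

Lemma imset_idE (N : finType) (A : {set N}) : id @: A = A.
Proof. by apply/setP=> x; rewrite -{1}[x]/(id x) mem_imset. Qed.

Lemma lions_iso_refl (d : nat) (N : finType) (J : Type) (m : J -> J -> Prop)
    (T : lions_data d N J) : (forall j j', m j j' -> j = j') -> lions_iso m T T id.
Proof.
move=> mE; split=> //; first by exists id.
  by move=> j j' /mE->; rewrite imset_idE.
rewrite -[LHS]imset_idE; apply: eq_imset => h /=; exact/esym/imset_idE.
Qed.

Lemma lions_iso_sym (d : nat) (N N' : finType) (J J' : Type)
    (m : J -> J' -> Prop) (m' : J' -> J -> Prop)
    (T : lions_data d N J) (T' : lions_data d N' J') phi psi :
  cancel phi psi -> cancel psi phi -> (forall j j', m' j' j -> m j j') ->
  lions_iso m T T' phi -> lions_iso m' T' T psi.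
Proof.
move=> fK gK mm [_ eE lE tE hE]; split.
- by exists phi.
- by move=> x y; rewrite -eE !gK.
- by move=> x; rewrite -lE gK.
- by move=> j' j /mm/tE->; rewrite -imset_comp (eq_imset _ (fK : _ =1 id)) imset_idE.
rewrite hE -imset_comp -[LHS]imset_idE; apply: eq_imset => h /=.
by rewrite -imset_comp (eq_imset _ (fK : _ =1 id)) imset_idE.
Qed.

Lemma lions_iso_trans (d : nat) (N N' N'' : finType) (J J' J'' : Type)
    (m : J -> J' -> Prop) (m' : J' -> J'' -> Prop) (m'' : J -> J'' -> Prop)
    (T : lions_data d N J) (T' : lions_data d N' J') (T'' : lions_data d N'' J'')
    phi psi :
  (forall j j'', m'' j j'' -> exists2 j', m j j' & m' j' j'') ->
  lions_iso m T T' phi -> lions_iso m' T' T'' psi ->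
  lions_iso m'' T T'' (psi \o phi).
Proof.
move=> mm [b eE lE tE hE] [b' eE' lE' tE' hE']; split=> /=.
- exact: bij_comp.
- by move=> x y; rewrite eE' eE.
- by move=> x; rewrite lE' lE.
- by move=> j j'' /mm[j' /tE jE /tE' ->]; rewrite jE -imset_comp.
by rewrite hE' hE -imset_comp; apply: eq_imset => h /=; rewrite -imset_comp.
Qed.

(* ------------------------------------------------------------------------ *)
(* Isomorphism classes of Lions forests. Every class has representatives on  *)
(* the node sets 'I_n.                                                       *)

Section Forests.
Variables (d : nat) (J : Type).

Definition pforest := {n : nat & lforest d 'I_n J}.

HB.instance Definition _ := gen_eqMixin pforest.
HB.instance Definition _ := gen_choiceMixin pforest.

Definition pforest_iso (P P' : pforest) : bool :=
  `[< exists phi, lions_iso eq (projT2 P) (projT2 P') phi >].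

Lemma pforest_iso_refl : reflexive pforest_iso.
Proof. by move=> P; apply/asboolP; exists id; apply: lions_iso_refl. Qed.

Lemma pforest_iso_sym : symmetric pforest_iso.
Proof.
suff imp P P' : pforest_iso P P' -> pforest_iso P' P by move=> P P'; apply/idP/idP; apply: imp.
move=> /asboolP[phi i]; have [[psi fK gK] _ _ _ _] := i.
by apply/asboolP; exists psi; apply: lions_iso_sym i.
Qed.

Lemma pforest_iso_trans : transitive pforest_iso.
Proof.
move=> P' P P'' /asboolP[phi i] /asboolP[psi i']; apply/asboolP.
by exists (psi \o phi); apply: lions_iso_trans i i' => j _ <-; exists j.
Qed.

Canonical pforest_equiv :=
  EquivRel pforest_iso pforest_iso_refl pforest_iso_sym pforest_iso_trans.

Definition forests := {eq_quot pforest_iso}.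

HB.instance Definition _ := Choice.on forests.
HB.instance Definition _ := EqQuotient.on forests.

End Forests.

Section OnOrdinals.
Variables (d : nat) (N : finType) (J : Type) (T : lforest d N J).

Lemma enum_val_up (x : 'I_#|N|) y :
  (enum_val x, y) \in edges T -> exists y' : 'I_#|N|, y = enum_val y'.
Proof. by move=> _; exists (enum_rank y); rewrite enum_rankK. Qed.

Definition on_ord : lforest d 'I_#|N| J := pull (@enum_val_inj N N) enum_val_up.

Definition forest_class : forests d J :=
  \pi_(forests d J) (existT (fun n => lforest d 'I_n J) #|N| on_ord).

Lemma on_ord_hedge (g : hedge T) :
  [set x : 'I_#|N| | enum_val x \in val g] \in hedges on_ord.
Proof.
apply/setD1P; split.
  have /set0Pn[x xg] := hedges_neq0 (laxioms T) (valP g).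
  by apply/set0Pn; exists (enum_rank x); rewrite inE enum_rankK.
apply/imsetP; exists (val g); first exact: (valP g).
by apply/setP=> x; rewrite !inE.
Qed.

(* The tags I + hedge T renamed when T is moved to ordinals.                 *)
Definition ord_tag (t : (J + hedge T)%type) : (J + hedge on_ord)%type :=
  match t with
  | inl j => inl j
  | inr g => inr (exist (fun h => h \in hedges on_ord) _ (on_ord_hedge g))
  end.

End OnOrdinals.

(* ------------------------------------------------------------------------ *)
(* Coupled pairs (Upsilon, Y) up to simultaneous isomorphism.                *)

Section Coupled.
Variables (d : nat) (I : Type).

Record pcoupled := PCoupled {
  coupled_root : pforest d I;
  coupled_prune : pforest d (I + hedge (projT2 coupled_root)) }.

HB.instance Definition _ := gen_eqMixin pcoupled.
HB.instance Definition _ := gen_choiceMixin pcoupled.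

Definition tag_match (N N' : finType) (Y : lions_data d N I)
    (Y' : lions_data d N' I) (phi : N -> N')
    (t : (I + hedge Y)%type) (t' : (I + hedge Y')%type) : Prop :=
  match t, t' with
  | inl i, inl i' => i = i'
  | inr g, inr g' => val g' = phi @: val g
  | _, _ => False
  end.

Definition pcoupled_iso (P P' : pcoupled) : bool :=
  `[< exists phi psi,
      lions_iso eq (projT2 (coupled_root P)) (projT2 (coupled_root P')) phi /\
      lions_iso (@tag_match _ _ _ _ phi)
        (projT2 (coupled_prune P)) (projT2 (coupled_prune P')) psi >].

Lemma hedge_map (N N' : finType) (Y : lions_data d N I) (Y' : lions_data d N' I)
    phi (g : hedge Y) : lions_iso eq Y Y' phi ->
  exists g' : hedge Y', val g' = phi @: val g.
Proof.
move=> [_ _ _ _ hE]; have gY : phi @: val g \in hedges Y'.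
  by rewrite hE; apply: imset_f; apply: (valP g).
by exists (exist (fun h => h \in hedges Y') _ gY).
Qed.

Lemma tag_match_refl (N : finType) (Y : lions_data d N I) t t' :
  @tag_match _ _ Y Y id t t' -> t = t'.
Proof.
case: t t' => [j|g] [j'|g'] //= => [->//|e]; congr inr.
by apply: val_inj; rewrite imset_idE in e; apply: esym.
Qed.

Lemma tag_match_sym (N N' : finType) (Y : lions_data d N I)
    (Y' : lions_data d N' I) phi psi t t' : cancel psi phi ->
  @tag_match _ _ Y' Y psi t' t -> @tag_match _ _ Y Y' phi t t'.
Proof.
move=> gK; case: t t' => [j|g] [j'|g'] //= ->.
by rewrite -imset_comp (eq_imset _ (gK : _ =1 id)) imset_idE.
Qed.

Lemma tag_match_trans (N N' N'' : finType) (Y : lions_data d N I)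
    (Y' : lions_data d N' I) (Y'' : lions_data d N'' I) phi psi t t'' :
  lions_iso eq Y Y' phi -> @tag_match _ _ Y Y'' (psi \o phi) t t'' ->
  exists2 t', @tag_match _ _ Y Y' phi t t' & @tag_match _ _ Y' Y'' psi t' t''.
Proof.
move=> i; case: t t'' => [j|g] [j''|g''] //= => [<-|e]; first by exists (inl j).
have [g' g'E] := hedge_map g i; exists (inr g') => //=.
by rewrite e g'E -imset_comp.
Qed.

Lemma pcoupled_iso_refl : reflexive pcoupled_iso.
Proof.
move=> P; apply/asboolP; exists id, id; split; apply: lions_iso_refl => //.
by move=> t t'; apply: tag_match_refl.
Qed.

Lemma pcoupled_iso_sym : symmetric pcoupled_iso.
Proof.
suff imp P P' : pcoupled_iso P P' -> pcoupled_iso P' P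
  by move=> P P'; apply/idP/idP; apply: imp.
move=> /asboolP[phi [psi [i j]]]; have [[phi' fK gK] _ _ _ _] := i.
have [[psi' pK qK] _ _ _ _] := j.
apply/asboolP; exists phi', psi'; split; first exact: lions_iso_sym i.
by apply: lions_iso_sym j => // t t'; apply: tag_match_sym.
Qed.

Lemma pcoupled_iso_trans : transitive pcoupled_iso.
Proof.
move=> P' P P'' /asboolP[f [g [i j]]] /asboolP[f' [g' [i' j']]]; apply/asboolP.
exists (f' \o f), (g' \o g); split.
  by apply: lions_iso_trans i i' => t _ <-; exists t.
by apply: lions_iso_trans j j' => t t''; apply: tag_match_trans.
Qed.

Canonical pcoupled_equiv :=
  EquivRel pcoupled_iso pcoupled_iso_refl pcoupled_iso_sym pcoupled_iso_trans.

Definition coupled := {eq_quot pcoupled_iso}.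

HB.instance Definition _ := Choice.on coupled.
HB.instance Definition _ := EqQuotient.on coupled.

Definition coupled_class (N M : finType) (Y : lforest d N I)
    (U : lforest d M (I + hedge Y)) : coupled :=
  \pi_coupled (@PCoupled (existT (fun n => lforest d 'I_n I) #|N| (on_ord Y))
    (existT (fun n => lforest d 'I_n (I + hedge (on_ord Y))) #|M|
       (push (@ord_tag _ _ _ Y) (on_ord U)))).

End Coupled.

(* ------------------------------------------------------------------------ *)
(* Quadruples ((Upsilon1, Upsilon2), (Y1, Y2)) up to simultaneous            *)
(* isomorphism, where both Upsilon_i have the tags of I and of Y1 and Y2.    *)

Section Quadruple.
Variables (d : nat) (I : Type).

Definition tags2 (N1 N2 : finType) (Y1 : lions_data d N1 I)
    (Y2 : lions_data d N2 I) := (I + hedge Y1 + hedge Y2)%type.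

Record pquad := PQuad {
  quad_root1 : pforest d I;
  quad_root2 : pforest d I;
  quad_prune1 : pforest d (tags2 (projT2 quad_root1) (projT2 quad_root2));
  quad_prune2 : pforest d (tags2 (projT2 quad_root1) (projT2 quad_root2)) }.

HB.instance Definition _ := gen_eqMixin pquad.
HB.instance Definition _ := gen_choiceMixin pquad.

Definition tag_match2 (N1 N1' N2 N2' : finType)
    (Y1 : lions_data d N1 I) (Y1' : lions_data d N1' I)
    (Y2 : lions_data d N2 I) (Y2' : lions_data d N2' I)
    (phi1 : N1 -> N1') (phi2 : N2 -> N2')
    (t : tags2 Y1 Y2) (t' : tags2 Y1' Y2') : Prop :=
  match t, t' with
  | inl s, inl s' => tag_match phi1 s s'
  | inr g, inr g' => val g' = phi2 @: val g
  | _, _ => False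
  end.

Lemma tag_match2_refl (N1 N2 : finType) (Y1 : lions_data d N1 I)
    (Y2 : lions_data d N2 I) t t' : @tag_match2 _ _ _ _ Y1 Y1 Y2 Y2 id id t t' -> t = t'.
Proof.
case: t t' => [s|g] [s'|g'] //= => [/tag_match_refl->//|e].
by congr inr; apply: val_inj; rewrite imset_idE in e; apply: esym.
Qed.

Section TagMatch2.
Variables (N1 N1' N1'' N2 N2' N2'' : finType).
Variables (Y1 : lions_data d N1 I) (Y1' : lions_data d N1' I) (Y1'' : lions_data d N1'' I).
Variables (Y2 : lions_data d N2 I) (Y2' : lions_data d N2' I) (Y2'' : lions_data d N2'' I).

Lemma tag_match2_sym f1 f2 f1' f2' (t : tags2 Y1 Y2) (t' : tags2 Y1' Y2') :
  cancel f1' f1 -> cancel f2' f2 ->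
  tag_match2 f1' f2' t' t -> tag_match2 f1 f2 t t'.
Proof.
move=> K1 K2; case: t t' => [s|g] [s'|g'] //=; first exact: tag_match_sym.
by move=> ->; rewrite -imset_comp (eq_imset _ (K2 : _ =1 id)) imset_idE.
Qed.

Lemma tag_match2_trans f1 f2 f1' f2' (t : tags2 Y1 Y2) (t'' : tags2 Y1'' Y2'') :
  lions_iso eq Y1 Y1' f1 -> lions_iso eq Y2 Y2' f2 ->
  tag_match2 (f1' \o f1) (f2' \o f2) t t'' ->
  exists2 t' : tags2 Y1' Y2', tag_match2 f1 f2 t t' & tag_match2 f1' f2' t' t''.
Proof.
move=> i1 i2; case: t t'' => [s|g] [s''|g''] //= => [m|e].
  by have [s' m1 m2] := tag_match_trans i1 m; exists (inl s').
have [g' g'E] := hedge_map g i2; exists (inr g') => //=.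
by rewrite e g'E -imset_comp.
Qed.

End TagMatch2.

Definition pquad_iso (P P' : pquad) : bool :=
  `[< exists phi1 phi2 psi1 psi2,
      [/\ lions_iso eq (projT2 (quad_root1 P)) (projT2 (quad_root1 P')) phi1,
          lions_iso eq (projT2 (quad_root2 P)) (projT2 (quad_root2 P')) phi2,
          lions_iso (@tag_match2 _ _ _ _ _ _ _ _ phi1 phi2)
            (projT2 (quad_prune1 P)) (projT2 (quad_prune1 P')) psi1
        & lions_iso (@tag_match2 _ _ _ _ _ _ _ _ phi1 phi2)
            (projT2 (quad_prune2 P)) (projT2 (quad_prune2 P')) psi2] >].

Lemma pquad_iso_refl : reflexive pquad_iso.
Proof.
move=> P; apply/asboolP; exists id, id, id, id.
by split; apply: lions_iso_refl => // t t'; apply: tag_match2_refl.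
Qed.

Lemma pquad_iso_sym : symmetric pquad_iso.
Proof.
suff imp P P' : pquad_iso P P' -> pquad_iso P' P
  by move=> P P'; apply/idP/idP; apply: imp.
move=> /asboolP[f1 [f2 [g1 [g2 [i1 i2 j1 j2]]]]].
have [[f1' fK1 fK1'] _ _ _ _] := i1; have [[f2' fK2 fK2'] _ _ _ _] := i2.
have [[g1' gK1 gK1'] _ _ _ _] := j1; have [[g2' gK2 gK2'] _ _ _ _] := j2.
apply/asboolP; exists f1', f2', g1', g2'; split.
- exact: lions_iso_sym i1.
- exact: lions_iso_sym i2.
- by apply: (lions_iso_sym gK1 gK1' _ j1) => t t'; apply: tag_match2_sym.
- by apply: (lions_iso_sym gK2 gK2' _ j2) => t t'; apply: tag_match2_sym.
Qed.

Lemma pquad_iso_trans : transitive pquad_iso.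
Proof.
move=> P' P P'' /asboolP[f1 [f2 [g1 [g2 [i1 i2 j1 j2]]]]].
move=> /asboolP[f1' [f2' [g1' [g2' [i1' i2' j1' j2']]]]].
apply/asboolP; exists (f1' \o f1), (f2' \o f2), (g1' \o g1), (g2' \o g2); split.
- by apply: lions_iso_trans i1 i1' => t _ <-; exists t.
- by apply: lions_iso_trans i2 i2' => t _ <-; exists t.
- by apply: lions_iso_trans j1 j1' => t t''; apply: tag_match2_trans.
- by apply: lions_iso_trans j2 j2' => t t''; apply: tag_match2_trans.
Qed.

Canonical pquad_equiv :=
  EquivRel pquad_iso pquad_iso_refl pquad_iso_sym pquad_iso_trans.

Definition quad := {eq_quot pquad_iso}.

HB.instance Definition _ := Choice.on quad.
HB.instance Definition _ := EqQuotient.on quad.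

(* Inclusions of I + H^Y1 and I + H^Y2 in I + H^Y1 + H^Y2, and               *)
(* identification of I + H^Y1 + H^Y2 with the tags of the product.           *)

Definition tag_inc1 (N1 N2 : finType) (Y1 : lions_data d N1 I)
    (Y2 : lions_data d N2 I) (t : (I + hedge Y1)%type) : tags2 Y1 Y2 := inl t.

Definition tag_inc2 (N1 N2 : finType) (Y1 : lions_data d N1 I)
    (Y2 : lions_data d N2 I) (t : (I + hedge Y2)%type) : tags2 Y1 Y2 :=
  match t with inl i => inl (inl i) | inr g => inr g end.

Section Merge.
Variables (N1 N2 : finType) (Y1 : lforest d N1 I) (Y2 : lforest d N2 I).

Lemma product_hedge1 (g : hedge Y1) : inl @: val g \in hedges (product Y1 Y2).
Proof. by rewrite inE imset_f // (valP g). Qed.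

Lemma product_hedge2 (g : hedge Y2) : inr @: val g \in hedges (product Y1 Y2).
Proof. by rewrite inE orbC imset_f // (valP g). Qed.

Definition tag_merge (t : tags2 Y1 Y2) : (I + hedge (product Y1 Y2))%type :=
  match t with
  | inl (inl i) => inl i
  | inl (inr g) =>
      inr (exist (fun h => h \in hedges (product Y1 Y2)) _ (product_hedge1 g))
  | inr g =>
      inr (exist (fun h => h \in hedges (product Y1 Y2)) _ (product_hedge2 g))
  end.

End Merge.
End Quadruple.

(* ------------------------------------------------------------------------ *)
(* The operations. Functions on isomorphism classes are computed on the      *)
(* representative [repr t]; they do not depend on this choice.               *)

Section Operations.
Variables (d : nat) (I : Type) (R : pzRingType).
Local Notation F := (forests d I).
Local Notation FF := (coupled d I).

Definition push_pforest (J K : Type) (f : J -> K) (P : pforest d J) : pforest d K :=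
  existT (fun n => lforest d 'I_n K) (projT1 P) (push f (projT2 P)).

Definition one_forest : F := forest_class (empty_forest d I).

Definition one_coupled : FF :=
  coupled_class (empty_forest d (I + hedge (empty_forest d I))).

Definition forest_product (t1 t2 : F) : F :=
  forest_class (product (projT2 (repr t1)) (projT2 (repr t2))).

Definition prod_map : fspan R (F * F)%type -> fspan R F :=
  lin (fun t => gen (forest_product t.1 t.2)).

Definition unit_map (r : R) : fspan R F := r *: gen one_forest.

Definition Delta : fspan R F -> fspan R FF :=
  lin (fun t : F =>
    \sum_(c : cut (projT2 (repr t))) gen (coupled_class (cut_prune c) : FF)
    : fspan R FF).

Definition counit : fspan R F -> R :=
  lin (M := R^o) (fun t => if t == one_forest then 1 else 0).

Definition twist (p : FF * FF) : quad d I :=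
  let P1 := repr p.1 in
  let P2 := repr p.2 in
  \pi_(quad d I) (@PQuad d I (coupled_root P1) (coupled_root P2)
    (push_pforest (@tag_inc1 _ _ _ _ _ _) (coupled_prune P1))
    (push_pforest (@tag_inc2 _ _ _ _ _ _) (coupled_prune P2))).

Definition Twist : fspan R (FF * FF)%type -> fspan R (quad d I) :=
  lin (fun p => gen (twist p)).

Definition quad_product (q : quad d I) : FF :=
  let Q := repr q in
  coupled_class (push
    (@tag_merge _ _ _ _ (projT2 (quad_root1 Q)) (projT2 (quad_root2 Q)))
    (product (projT2 (quad_prune1 Q)) (projT2 (quad_prune2 Q)))).

Definition coupled_prod_map : fspan R (quad d I) -> fspan R FF :=
  lin (fun q => gen (quad_product q)).

Definition Delta_Delta : fspan R (F * F)%type -> fspan R (FF * FF)%type :=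
  lin2 (@tensor R FF FF) Delta Delta.

Definition mul_counit_counit : fspan R (F * F)%type -> R :=
  lin2 (M1 := R^o) (M2 := R^o) (M := R^o) *%R counit counit.

Definition unit_unit (r s : R) : fspan R FF := (r * s) *: gen one_coupled.

End Operations.

Arguments unit_map d I {R} r.
Arguments unit_unit d I {R} r s.
Arguments Delta d I R u : clear implicits.
Arguments prod_map d I R u : clear implicits.
Arguments coupled_prod_map d I R u : clear implicits.
Arguments Twist d I R u : clear implicits.
Arguments Delta_Delta d I R u : clear implicits.
Arguments counit d I R u : clear implicits.
Arguments mul_counit_counit d I R u : clear implicits.

(* Main.v *)
Require Import Defs.
From mathcomp Require Import all_boot all_algebra.
From mathcomp Require Import generic_quotient finmap monalg boolp.

Set Implicit Arguments.
Unset Strict Implicit.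
Unset Printing Implicit Defensive.

Import GRing.Theory.
Local Open Scope quotient_scope.
Local Open Scope ring_scope.

(** The three identities about [counit] and the unit are direct: a product of
    two forests is empty exactly when both factors are, and the empty forest
    has a single cut. The content is the compatibility of the coproduct with
    the product.

    A cut of a forest is determined by its set of root nodes: on each
    tree, a non-empty cut is the set of edges that enter the root nodes, while
    the two formal cuts give the whole tree and the empty set. The sets that occur are
    exactly those closed under taking parents, because a path to the root
    enters such a set at most once. Hence the coproduct is a sum over
    parent-closed sets of nodes ([big_cut]). This makes it invariant under
    isomorphism of forests ([cut_sum_iso]), and as the parent-closed sets of a
    disjoint union are the pairs of parent-closed sets of the two parts, the
    cuts [c] of a product correspond to pairs [(c1, c2)] of cuts of the
    factors.

    It remains to see that the pair (prune, root) of [c] is the product, after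
    the twist, of the pairs of [c1] and [c2] ([product_cut_iso]). The root and
    prune of a cut are characterized, up to simultaneous isomorphism, by their
    edges, labels and tags and by the relation that two nodes lie in a common
    hyperedge ([cut_coupled_iso]). In a product no hyperedge meets both parts,
    so all of these can be read off part by part; in particular a hyperedge of
    the root of [c] lies in one of the two parts and tags only nodes of the
    prune in that part, which is why the additional tags of the twist are
    empty.

    All operations on isomorphism classes are computed on representatives, so
    isomorphisms of coupled pairs and of quadruples on arbitrary node sets are
    followed through the twist and the products ([quad_product_twist]). *)

(** * Linear extension *)

Section Lin.
Variables (R : pzRingType) (S : choiceType) (M : lmodType R) (f : S -> M).
Implicit Types (u v : fspan R S).

Lemma lin_sub u (D : {fset S}) : (msupp u `<=` D)%fset ->
  lin f u = \sum_(s <- D) u@_s *: f s.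
Proof.
move=> sD; rewrite /lin; apply: big_fset_incl => // s _ /mcoeff_outdom ->.
by rewrite scale0r.
Qed.

Lemma linD u v : lin f (u + v) = lin f u + lin f v.
Proof.
rewrite (lin_sub (msuppD_le u v)) (lin_sub (fsubsetUl (msupp u) (msupp v))).
rewrite (lin_sub (fsubsetUr (msupp u) (msupp v))) -big_split /=.
by apply: eq_bigr => s _; rewrite mcoeffD scalerDl.
Qed.

Lemma linZ a u : lin f (a *: u) = a *: lin f u.
Proof.
have sD : (msupp (a *: u) `<=` msupp u)%fset.
  apply/fsubsetP=> s; rewrite -!mcoeff_neq0 span_scaleE.
  by apply: contraNneq => ->; rewrite mulr0.
rewrite (lin_sub sD) scaler_sumr; apply: eq_bigr => s _.
by rewrite span_scaleE scalerA.
Qed.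

Lemma lin0 : lin f 0 = 0.
Proof. by rewrite -(scale0r 0) linZ scale0r. Qed.

(** Valid also in the zero ring, where all generators vanish, since every module
    over it is zero. *)
Lemma lin_gen s : lin f (gen s) = f s.
Proof.
by rewrite (lin_sub msuppU_le) big_seq_fset1 mcoeffUU scale1r.
Qed.

Lemma lin_sum (K : Type) (r : seq K) (P : pred K) (u : K -> fspan R S) :
  lin f (\sum_(i <- r | P i) u i) = \sum_(i <- r | P i) lin f (u i).
Proof. exact: (big_morph _ linD lin0). Qed.

Lemma eq_lin g : f =1 g -> lin f =1 lin g.
Proof. by move=> fg u; apply: eq_bigr => s _; rewrite fg. Qed.

End Lin.

Lemma lin_lin (R : pzRingType) (S S' : choiceType) (M : lmodType R)
    (f : S -> fspan R S') (g : S' -> M) u :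
  lin g (lin f u) = lin (fun s => lin g (f s)) u.
Proof. by rewrite [lin f u]/lin lin_sum; apply: eq_bigr => s _; rewrite linZ. Qed.

Lemma tensor_sum (R : pzRingType) (S1 S2 : choiceType) (K1 K2 : finType)
    (f1 : K1 -> S1) (f2 : K2 -> S2) :
  tensor (\sum_i gen (f1 i) : fspan R S1) (\sum_j gen (f2 j))
  = \sum_i \sum_j gen (f1 i, f2 j).
Proof.
rewrite /tensor lin_sum; apply: eq_bigr => i _; rewrite lin_gen lin_sum.
by apply: eq_bigr => j _; rewrite lin_gen.
Qed.

(** * Cuts and sets of nodes closed under taking parents *)

Section UpClosed.
Variables (N : finType) (E : {set N * N}).
Hypothesis fE : directed_forest E.
Implicit Types (D : {set N}).

(** Closed under taking parents. *)
Definition up_closed D := [forall e in E, (e.1 \in D) ==> (e.2 \in D)].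

Lemma up_closedP D : reflect (forall x y, (x, y) \in E -> x \in D -> y \in D)
  (up_closed D).
Proof.
rewrite /up_closed; apply: (iffP forall_inP) => [cD x y xy xD|cD [x y] xy].
  by move: (cD _ xy); rewrite /= xD.
by apply/implyP; apply: cD xy.
Qed.

(** The edges along which a path to the root enters [D]. *)
Definition boundary D := [set e in E | (e.1 \notin D) && (e.2 \in D)].

Lemma in_boundary D x y :
  ((x, y) \in boundary D) = [&& (x, y) \in E, x \notin D & y \in D].
Proof. by rewrite inE. Qed.

Lemma in_tree_edges (d : nat) (J : Type) (T : lforest d N J) r x y :
  ((x, y) \in tree_edges T r)
  = ((x, y) \in edges T) && connect (edge_rel (edges T)) x r.
Proof. by rewrite inE. Qed.

Lemma up_closed_connect D x y : up_closed D -> connect (edge_rel E) x y ->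
  x \in D -> y \in D.
Proof.
move=> /up_closedP cD /connectP[p pp ->]; elim: p x pp => //= z p IH x.
by case/andP=> xz pp xD; apply: IH pp _; apply: cD xz xD.
Qed.

Lemma path_edges_root x : is_root E x -> path_edges E x = set0.
Proof. by move=> rx; apply/eqP; rewrite -cards_eq0; apply/eqP/depth_root. Qed.

Lemma boundary_out D x : up_closed D -> x \in D ->
  [disjoint boundary D & path_edges E x].
Proof.
move=> cD xD; rewrite -setI_eq0; apply/eqP/setP=> e; rewrite !inE.
apply/negP=> /andP[/and3P[eE /negP e1 _] /andP[_ xe]].
by apply: e1; apply: up_closed_connect xe xD.
Qed.

(** In a tree whose root lies in [D], the set [D] consists of the nodes above its
    boundary. *)
Lemma boundary_above D x r : up_closed D -> r \in D -> is_root E r ->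
  connect (edge_rel E) x r ->
  [disjoint boundary D & path_edges E x] = (x \in D).
Proof.
move=> cD rD rr xr; apply/idP/idP; last exact: boundary_out.
move: x xr; apply: (up_ind fE) => x IH xr.
have [rx|/rootPn[y xy]] := boolP (is_root E x).
  by move=> _; rewrite (forest_root_uniq fE rx rr (connect0 _ x) xr).
have yr : connect (edge_rel E) y r.
  have [s rs ys] := forest_root y fE.
  suff -> : r = s by [].
  by apply: (forest_root_uniq fE rr rs xr); apply: connect_trans (connect1 _) ys.
rewrite (path_edges_step fE xy) => dx.
have yD : y \in D by apply: (IH y xy yr); apply: disjointWr dx; apply: subsetUr.
apply: contraT => xD; move: dx; rewrite -setI_eq0 => /eqP/setP/(_ (x, y)).
by rewrite !inE /= xy xD yD eqxx.
Qed.

(** A path to the root enters an upward closed set at most once. *)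
Lemma boundary_card D x : up_closed D -> (#|boundary D :&: path_edges E x| <= 1)%N.
Proof.
move=> cD; move: x; apply: (up_ind fE) => x IH.
have [rx|/rootPn[y xy]] := boolP (is_root E x).
  by rewrite (path_edges_root rx) setI0 cards0.
rewrite (path_edges_step fE xy).
have [yD|yD] := boolP (y \in D).
  rewrite setIUr; have := boundary_out cD yD; rewrite -setI_eq0 => /eqP->.
  rewrite setU0; apply: leq_trans (subset_leq_card (subsetIr _ _)) _.
  by rewrite cards1.
apply: leq_trans (IH y xy); apply: subset_leq_card; apply/subsetP=> e.
rewrite !inE => /andP[/and3P[eE e1 e2] /orP[/eqP ee|/andP[_ ye]]].
  by move: e2; rewrite ee (negPf yD).
by rewrite eE e1 e2 ye.
Qed.

End UpClosed.

Section CutUpClosed.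
Variables (d : nat) (N : finType) (J : Type) (T : lforest d N J).
Let E := edges T.
Let fT : directed_forest E := lions_forest (laxioms T).
Implicit Types (D : {set N}) (c : cut T).

Lemma root_nodes_up_closed c : up_closed E (root_nodes c).
Proof. by apply/up_closedP=> x y; apply: root_nodes_up. Qed.

(** The boundary of a set closed under parents, tree by tree; on a tree that
    lies inside or outside the set, the formal cut of the matching sign. *)
Definition set_tree_cut D r : tree_cut N :=
  if r \notin D then inr false
  else if boundary E D :&: tree_edges T r == set0 then inr true
  else inl (boundary E D :&: tree_edges T r).

(* the condition that defines the cuts of T *)
Let is_cut (f : {ffun root_of T -> tree_cut N}) :=
  [forall r : root_of T, admissible T (val r) (f r)].

Let set_cut D : {ffun root_of T -> tree_cut N} :=
  [ffun r : root_of T => set_tree_cut D (val r)].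

Lemma set_cut_admissible D : up_closed E D -> is_cut (set_cut D).
Proof.
move=> cD; apply/forallP=> r; rewrite ffunE /set_tree_cut.
case: ifP => // _; case: ifP => //= b0; rewrite b0 subsetIr /=.
apply/forall_inP=> x _; apply: leq_trans (boundary_card fT x cD).
by apply: subset_leq_card; rewrite setSI // subsetIl.
Qed.

Lemma full_cut_admissible : is_cut [ffun=> inr true].
Proof. by apply/forallP=> r; rewrite ffunE. Qed.

(** The cut with root nodes [D]; its value when [D] is not closed under parents
    is irrelevant. *)
Definition cut_of D : cut T :=
  insubd (exist (fun f => is_true (is_cut f)) _ full_cut_admissible) (set_cut D).

Lemma path_edges_tree x r : is_root E r -> connect (edge_rel E) x r ->
  path_edges E x \subset tree_edges T r.
Proof.
move=> rr xr; apply/subsetP=> e; rewrite !inE => /andP[-> xe] /=.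
have [s rs es] := forest_root e.1 fT.
suff -> : r = s by [].
by apply: (forest_root_uniq fT rr rs xr); apply: connect_trans xe es.
Qed.

Lemma root_nodes_cut_of D : up_closed E D -> root_nodes (cut_of D) = D.
Proof.
move=> cD; apply/setP=> x; have [r rr xr] := forest_root x fT.
rewrite (root_nodesP (cut_of D) (r := exist _ r rr) rr xr).
have -> : val (cut_of D) = set_cut D by exact: (insubdK _ (set_cut_admissible cD)).
rewrite ffunE /=.
rewrite /set_tree_cut; case: ifPn => [rD|].
  by apply/esym/negbTE; apply: contra rD; apply: up_closed_connect cD xr.
rewrite negbK => rD; have eD := boundary_above fT cD rD rr xr.
have eI : (boundary E D :&: tree_edges T r) :&: path_edges E x
        = boundary E D :&: path_edges E x.
  by rewrite -setIA (setIidPr (path_edges_tree rr xr)).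
case: ifP => [/eqP b0|_] /=; last by rewrite -eD -!setI_eq0 eI.
by rewrite -eD -setI_eq0 -eI b0 set0I eqxx.
Qed.

(** The edges of a cut are those that enter its root nodes: an edge of the cut
    starts outside, and ends inside since no second cut edge lies above it. *)
Lemma cut_edges c (r : root_of T) (s : {set N * N}) : val c r = inl s ->
  s = boundary E (root_nodes c) :&: tree_edges T (val r).
Proof.
move=> cr; have rr : is_root E (val r) := valP r.
have /forallP/(_ r) := valP c; rewrite cr => /= /and3P[_ /subsetP sE /forall_inP s1].
have xR x : connect (edge_rel E) x (val r) ->
    (x \in root_nodes c) = [disjoint s & path_edges E x].
  by move=> xr; rewrite (root_nodesP c (r := r) rr xr) cr.
apply/setP=> -[x y]; have [xy|xy] := boolP ((x, y) \in E); last first.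
  by rewrite !inE (negPf xy) /=; apply/negP=> /sE; rewrite inE (negPf xy).
have [xr|xr] := boolP (connect (edge_rel E) x (val r)); last first.
  rewrite !inE /= (negPf xr) !andbF; apply/negP=> /sE.
  by rewrite inE /= (negPf xr) andbF.
have yr : connect (edge_rel E) y (val r).
  have [t rt yt] := forest_root y fT.
  suff -> : val r = t by [].
  by apply: (forest_root_uniq fT rr rt xr); apply: connect_trans (connect1 _) yt.
have xyP : (x, y) \in path_edges E x by rewrite inE /= xy connect0.
have xyN : (x, y) \notin path_edges E y.
  by rewrite inE /= negb_and forest_no_back // orbT.
rewrite in_setI in_boundary in_tree_edges xy xr /= andbT !xR //.
apply/idP/andP=> [xys|[xs ys]].
  split; first by apply/negP=> /disjointFr/(_ xys); rewrite xyP.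
  (* another edge e of the cut above y would meet the path of x twice *)
  apply: contraT; rewrite -setI_eq0 => /set0Pn[e /setIP[es ey]].
  have exy : e != (x, y) by apply: contraNneq xyN => <-.
  have := s1 _ xr; rewrite (cardD1 e) (cardD1 (x, y)) !inE /= es xys xy connect0.
  rewrite eq_sym (negPf exy) /=.
  have -> : (e \in E) && connect (edge_rel E) x e.1.
    by move: ey; rewrite inE => /andP[-> /(connect_trans (connect1 _)) ->].
  by [].
move: xs; rewrite -setI_eq0 => /set0Pn[e /setIP[es]].
rewrite (path_edges_step fT xy) in_setU1 => /orP[/eqP <-//|ey].
by rewrite (disjointFr ys es) in ey.
Qed.

Lemma root_nodes_inj : injective (@root_nodes _ _ _ T).
Proof.
move=> c c' cc'; apply/val_inj/ffunP=> r.
have rr : is_root E (val r) := valP r.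
have bE (k : cut T) b x : val k r = inr b -> connect (edge_rel E) x (val r) ->
    (x \in root_nodes k) = b.
  by move=> kr xr; rewrite (root_nodesP k (r := r) rr xr) kr.
(* a non-empty set of edges leaves the root of its tree among the root nodes,
   and some other node of the tree outside; the formal cuts do not *)
have sE (k : cut T) s : val k r = inl s ->
    (val r \in root_nodes k) /\ exists2 x, connect (edge_rel E) x (val r) &
      x \notin root_nodes k.
  move=> kr; split.
    by rewrite (root_nodesP k (r := r) rr (connect0 _ _)) kr /= path_edges_root //
      -setI_eq0 setI0.
  have /forallP/(_ r) := valP k; rewrite kr => /= /and3P[/set0Pn[e es] _ _].
  case: e es => x y; rewrite (cut_edges kr) in_setI in_boundary in_tree_edges.
  by case/andP=> /and3P[_ xR _] /andP[_ xr]; exists x.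
have excl (k k' : cut T) s b : root_nodes k = root_nodes k' ->
    val k r = inl s -> val k' r = inr b -> False.
  move=> e /sE[rk [x xr xk]] /bE bk; move: rk xk; rewrite e !bk ?connect0 //.
  by move=> ->.
case cr: (val c r) => [s|b]; case cr': (val c' r) => [s'|b'].
- by rewrite (cut_edges cr) (cut_edges cr') cc'.
- by case: (excl _ _ _ _ cc' cr cr').
- by case: (excl _ _ _ _ (esym cc') cr' cr).
by rewrite -(bE _ _ _ cr (connect0 _ _)) -(bE _ _ _ cr' (connect0 _ _)) cc'.
Qed.

Lemma cut_ofK c : cut_of (root_nodes c) = c.
Proof. by apply/root_nodes_inj/root_nodes_cut_of/root_nodes_up_closed. Qed.

(** A sum over cuts is a sum over the sets closed under parents. *)
Lemma big_cut (V : nmodType) (G : cut T -> V) :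
  \sum_(c : cut T) G c = \sum_(D | up_closed E D) G (cut_of D).
Proof.
rewrite (reindex_onto cut_of (@root_nodes _ _ _ T)) /=; last first.
  by move=> c _; apply: cut_ofK.
apply: eq_bigl => D; apply/eqP/idP=> [<-|]; first exact: root_nodes_up_closed.
exact: root_nodes_cut_of.
Qed.

End CutUpClosed.

(** * Isomorphisms *)

Section Iso.
Variable d : nat.

Lemma on_ord_iso (N : finType) (J : Type) (T : lforest d N J) :
  lions_iso eq T (on_ord T) enum_rank.
Proof.
have pE (A : {set N}) : enum_val @^-1: A = enum_rank @: A.
  by rewrite (can2_imset_pre _ (@enum_rankK N) (@enum_valK N)).
split=> /=.
- exact: enum_rank_bij.
- by move=> x y; rewrite inE /= !enum_rankK.
- by move=> x; rewrite enum_rankK.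
- by move=> j j' <-; apply: pE.
rewrite (eq_imset _ pE); apply/setDidPl; rewrite disjoint_sym disjoints1.
apply/imsetP=> -[h hT] /esym/eqP; rewrite imset_eq0.
by rewrite (negPf (hedges_neq0 (laxioms T) hT)).
Qed.

Lemma push_iso (N : finType) (J K : Type) (f : J -> K) (T : lforest d N J) :
  injective f -> lions_iso (fun j k => k = f j) T (push f T) id.
Proof.
move=> fI; split=> //=; first by exists id.
  move=> j _ ->; rewrite imset_idE; apply/setP=> x; rewrite inE.
  by apply/asboolP/idP=> [[j' /fI->]|xj] //; exists j.
by rewrite (eq_imset (g := id)) ?imset_idE // => h; apply: imset_idE.
Qed.

(** Change of tags on both sides of an isomorphism, along [f] and [f']: new tags
    that correspond must come from old tags that correspond. *)
Lemma push_iso2 (N N' : finType) (J J' K K' : Type) (m : J -> J' -> Prop)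
    (m' : K -> K' -> Prop) (f : J -> K) (f' : J' -> K')
    (T : lforest d N J) (T' : lforest d N' J') phi :
  (forall k k' j, m' k k' -> f j = k -> exists2 j', m j j' & f' j' = k') ->
  (forall k k' j', m' k k' -> f' j' = k' -> exists2 j, m j j' & f j = k) ->
  lions_iso m T T' phi -> lions_iso m' (push f T) (push f' T') phi.
Proof.
move=> l r [b eE lE tE hE]; split=> //= k k' kk'.
have inj := bij_inj b.
apply/setP=> y; rewrite inE; apply/asboolP/imsetP.
  move=> [j' fj' yj']; have [j jj' fj] := r _ _ _ kk' fj'.
  move: yj'; rewrite (tE _ _ jj') => /imsetP[x xj ->]; exists x => //.
  by rewrite inE; apply/asboolP; exists j.
move=> [x]; rewrite inE => /asboolP[j fj xj] ->.
have [j' jj' fj'] := l _ _ _ kk' fj; exists j' => //.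
by rewrite (tE _ _ jj') imset_f.
Qed.

(** The map induced by [f] and [g] on disjoint unions. *)
Definition sum_map (A A' B B' : Type) (f : A -> A') (g : B -> B') (x : A + B) :
    A' + B' :=
  match x with inl a => inl (f a) | inr b => inr (g b) end.

Lemma sum_map_bij (A A' B B' : Type) (f : A -> A') (g : B -> B') :
  bijective f -> bijective g -> bijective (sum_map f g).
Proof.
move=> [f' fK f'K] [g' gK g'K]; exists (sum_map f' g').
  by case=> x /=; rewrite ?fK ?gK.
by case=> x /=; rewrite ?f'K ?g'K.
Qed.

Lemma imset_sum_inl (A A' B B' : finType) (f : A -> A') (g : B -> B') (S : {set A}) :
  sum_map f g @: (inl @: S) = inl @: (f @: S).
Proof. by rewrite -!imset_comp. Qed.

Lemma imset_sum_inr (A A' B B' : finType) (f : A -> A') (g : B -> B') (S : {set B}) :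
  sum_map f g @: (inr @: S) = inr @: (g @: S).
Proof. by rewrite -!imset_comp. Qed.

Lemma product_iso (N1 N1' N2 N2' : finType) (J J' : Type) (m : J -> J' -> Prop)
    (T1 : lforest d N1 J) (T1' : lforest d N1' J')
    (T2 : lforest d N2 J) (T2' : lforest d N2' J') phi1 phi2 :
  lions_iso m T1 T1' phi1 -> lions_iso m T2 T2' phi2 ->
  lions_iso m (product T1 T2) (product T1' T2') (sum_map phi1 phi2).
Proof.
move=> [b1 eE1 lE1 tE1 hE1] [b2 eE2 lE2 tE2 hE2]; split=> /=.
- exact: sum_map_bij.
- by move=> [x|x] [y|y]; rewrite !inE /=.
- by case.
- move=> j j' jj'; rewrite imsetU imset_sum_inl imset_sum_inr.
  by rewrite (tE1 _ _ jj') (tE2 _ _ jj').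
rewrite imsetU hE1 hE2 -!imset_comp; congr (_ :|: _).
  by apply: eq_imset => h /=; rewrite imset_sum_inl.
by apply: eq_imset => h /=; rewrite imset_sum_inr.
Qed.

Lemma hedges_empty (N : finType) (J : Type) (T : lforest d N J) :
  (forall x : N, False) -> hedges T = set0.
Proof.
move=> N0; apply/setP=> h; rewrite inE; apply/negP=> hT.
by have /set0Pn[x] := hedges_neq0 (laxioms T) hT; case: (N0 x).
Qed.

Lemma empty_iso (N N' : finType) (J J' : Type) (m : J -> J' -> Prop)
    (T : lforest d N J) (T' : lforest d N' J') :
  (forall x : N, False) -> (forall x : N', False) ->
  exists phi, lions_iso m T T' phi.
Proof.
move=> N0 N0'; exists (fun x => match N0 x with end); split.
- by exists (fun x => match N0' x with end) => x; [case: (N0 x)|case: (N0' x)].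
- by move=> x; case: (N0 x).
- by move=> x; case: (N0 x).
- by move=> j j' _; apply/setP=> x; case: (N0' x).
by rewrite (hedges_empty T' N0') (hedges_empty T N0) imset0.
Qed.

Lemma forest_class_eq (N N' : finType) (J : Type) (T : lforest d N J)
    (T' : lforest d N' J) phi : lions_iso eq T T' phi ->
  forest_class T = forest_class T'.
Proof.
move=> i; have [g rK Kr] := @enum_rank_bij N.
have s : lions_iso eq (on_ord T) T g.
  by apply: lions_iso_sym (on_ord_iso T).
apply/eqmodP/asboolP; exists (enum_rank \o (phi \o g)).
apply: lions_iso_trans (on_ord_iso T'); first by move=> j _ <-; exists j.
by apply: lions_iso_trans s i; move=> j _ <-; exists j.
Qed.

Lemma repr_forest_class (N : finType) (J : Type) (T : lforest d N J) :
  exists phi, lions_iso eq T (projT2 (repr (forest_class T))) phi.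
Proof.
have : \pi_(forests d J) (existT (fun n => lforest d 'I_n J) #|N| (on_ord T))
  = \pi_(forests d J) (repr (forest_class T)) by rewrite reprK.
move=> /eqmodP/asboolP[phi i]; exists (phi \o enum_rank).
by apply: lions_iso_trans (on_ord_iso T) i; move=> j _ <-; exists j.
Qed.

Lemma forest_class_repr (J : Type) (t : forests d J) :
  forest_class (projT2 (repr t)) = t.
Proof.
rewrite -[RHS]reprK; have [g rK Kr] := @enum_rank_bij 'I_(projT1 (repr t)).
apply/eqmodP/asboolP; exists g.
exact: lions_iso_sym (on_ord_iso _).
Qed.

End Iso.

Section CoupledIso.
Variables (d : nat) (I : Type).

(** Simultaneous isomorphism of coupled pairs on arbitrary node sets. *)
Definition coupled_iso (N M N' M' : finType)
    (Y : lforest d N I) (U : lforest d M (I + hedge Y))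
    (Y' : lforest d N' I) (U' : lforest d M' (I + hedge Y')) : Prop :=
  exists phi psi,
    lions_iso eq Y Y' phi /\ lions_iso (@tag_match _ _ _ _ Y Y' phi) U U' psi.

Lemma coupled_iso_sym (N M N' M' : finType)
    (Y : lforest d N I) (U : lforest d M (I + hedge Y))
    (Y' : lforest d N' I) (U' : lforest d M' (I + hedge Y')) :
  coupled_iso U U' -> coupled_iso U' U.
Proof.
move=> [phi [psi [i j]]]; have [[phi' fK gK] _ _ _ _] := i.
have [[psi' pK qK] _ _ _ _] := j.
exists phi', psi'; split; first exact: lions_iso_sym i.
by apply: lions_iso_sym j => // t t'; apply: tag_match_sym.
Qed.

Lemma coupled_iso_trans (N M N' M' N'' M'' : finType)
    (Y : lforest d N I) (U : lforest d M (I + hedge Y))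
    (Y' : lforest d N' I) (U' : lforest d M' (I + hedge Y'))
    (Y'' : lforest d N'' I) (U'' : lforest d M'' (I + hedge Y'')) :
  coupled_iso U U' -> coupled_iso U' U'' -> coupled_iso U U''.
Proof.
move=> [f [g [i j]]] [f' [g' [i' j']]]; exists (f' \o f), (g' \o g); split.
  by apply: lions_iso_trans i i' => t _ <-; exists t.
by apply: lions_iso_trans j j' => t t''; apply: tag_match_trans.
Qed.

Lemma ord_tag_inj (N : finType) (Y : lforest d N I) : injective (@ord_tag _ _ _ Y).
Proof.
move=> [i|g] [i'|g'] //= => [[->]//|[/setP e]]; congr inr.
by apply/val_inj/setP=> x; move: (e (enum_rank x)); rewrite !inE enum_rankK.
Qed.

Lemma on_ord_coupled (N M : finType) (Y : lforest d N I)
    (U : lforest d M (I + hedge Y)) :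
  coupled_iso U (push (@ord_tag _ _ _ Y) (on_ord U)).
Proof.
exists enum_rank, (id \o enum_rank); split; first exact: on_ord_iso.
apply: lions_iso_trans (on_ord_iso U) (push_iso _ (@ord_tag_inj _ Y)).
move=> t t' tt'; exists t => //; case: t t' tt' => [i|g] [i'|g'] //=; first by move->.
move=> e; congr inr; apply: val_inj => /=; rewrite [LHS]e.
by rewrite (can2_imset_pre _ (@enum_rankK N) (@enum_valK N)).
Qed.

Lemma coupled_class_eq (N M N' M' : finType)
    (Y : lforest d N I) (U : lforest d M (I + hedge Y))
    (Y' : lforest d N' I) (U' : lforest d M' (I + hedge Y')) :
  coupled_iso U U' -> coupled_class U = coupled_class U'.
Proof.
move=> i; apply/eqmodP/asboolP.
apply: (coupled_iso_trans (coupled_iso_sym (on_ord_coupled U))).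
exact: coupled_iso_trans i (on_ord_coupled U').
Qed.

Lemma repr_coupled_class (N M : finType)
    (Y : lforest d N I) (U : lforest d M (I + hedge Y)) :
  coupled_iso U (projT2 (coupled_prune (repr (coupled_class U)))).
Proof.
apply: (coupled_iso_trans (on_ord_coupled U)).
have e : coupled_class U = \pi_(coupled d I) (repr (coupled_class U)) by rewrite reprK.
by move/eqmodP/asboolP: e.
Qed.

(** Simultaneous isomorphism of quadruples on arbitrary node sets. *)
Definition quad_iso (N1 N2 M1 M2 N1' N2' M1' M2' : finType)
    (Y1 : lforest d N1 I) (Y2 : lforest d N2 I)
    (U1 : lforest d M1 (tags2 Y1 Y2)) (U2 : lforest d M2 (tags2 Y1 Y2))
    (Y1' : lforest d N1' I) (Y2' : lforest d N2' I)
    (U1' : lforest d M1' (tags2 Y1' Y2')) (U2' : lforest d M2' (tags2 Y1' Y2')) :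
    Prop :=
  exists phi1 phi2 psi1 psi2,
    [/\ lions_iso eq Y1 Y1' phi1, lions_iso eq Y2 Y2' phi2,
        lions_iso (@tag_match2 _ _ _ _ _ _ Y1 Y1' Y2 Y2' phi1 phi2) U1 U1' psi1
      & lions_iso (@tag_match2 _ _ _ _ _ _ Y1 Y1' Y2 Y2' phi1 phi2) U2 U2' psi2].

Lemma hedge_map_inv (N N' : finType) (Y : lforest d N I) (Y' : lforest d N' I)
    phi (g' : hedge Y') : lions_iso eq Y Y' phi ->
  exists g : hedge Y, val g' = phi @: val g.
Proof.
move=> [_ _ _ _ hE].
have /imsetP[h hY gE] : val g' \in [set phi @: (h : {set N}) | h in hedges Y].
  by rewrite -hE; apply: (valP g').
by exists (exist (fun h => h \in hedges Y) h hY).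
Qed.

Lemma quad_iso_trans (N1 N2 M1 M2 N1' N2' M1' M2' N1'' N2'' M1'' M2'' : finType)
    (Y1 : lforest d N1 I) (Y2 : lforest d N2 I)
    (U1 : lforest d M1 (tags2 Y1 Y2)) (U2 : lforest d M2 (tags2 Y1 Y2))
    (Y1' : lforest d N1' I) (Y2' : lforest d N2' I)
    (U1' : lforest d M1' (tags2 Y1' Y2')) (U2' : lforest d M2' (tags2 Y1' Y2'))
    (Y1'' : lforest d N1'' I) (Y2'' : lforest d N2'' I)
    (U1'' : lforest d M1'' (tags2 Y1'' Y2''))
    (U2'' : lforest d M2'' (tags2 Y1'' Y2'')) :
  quad_iso U1 U2 U1' U2' -> quad_iso U1' U2' U1'' U2'' -> quad_iso U1 U2 U1'' U2''.
Proof.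
move=> [f1 [f2 [g1 [g2 [i1 i2 j1 j2]]]]] [f1' [f2' [g1' [g2' [i1' i2' j1' j2']]]]].
exists (f1' \o f1), (f2' \o f2), (g1' \o g1), (g2' \o g2); split.
- by apply: lions_iso_trans i1 i1' => t _ <-; exists t.
- by apply: lions_iso_trans i2 i2' => t _ <-; exists t.
- by apply: lions_iso_trans j1 j1' => t t''; apply: tag_match2_trans.
- by apply: lions_iso_trans j2 j2' => t t''; apply: tag_match2_trans.
Qed.

Section Merge.
Variables (N1 N2 M1 M2 N1' N2' M1' M2' : finType).
Variables (Y1 : lforest d N1 I) (Y2 : lforest d N2 I).
Variables (Y1' : lforest d N1' I) (Y2' : lforest d N2' I).

(** Adding empty tags preserves isomorphism, so the twist does not depend on
    representatives. *)
Lemma twist_iso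
    (U1 : lforest d M1 (I + hedge Y1)) (U2 : lforest d M2 (I + hedge Y2))
    (U1' : lforest d M1' (I + hedge Y1')) (U2' : lforest d M2' (I + hedge Y2')) :
  coupled_iso U1 U1' -> coupled_iso U2 U2' ->
  quad_iso (push (@tag_inc1 _ _ _ _ Y1 Y2) U1) (push (@tag_inc2 _ _ _ _ Y1 Y2) U2)
    (push (@tag_inc1 _ _ _ _ Y1' Y2') U1') (push (@tag_inc2 _ _ _ _ Y1' Y2') U2').
Proof.
move=> [f1 [g1 [i1 j1]]] [f2 [g2 [i2 j2]]]; exists f1, f2, g1, g2; split=> //.
  apply: push_iso2 j1.
    by move=> k [s|g] j + kE; rewrite -{}kE //= => m; exists s.
  by move=> [s|g] k' j' + kE; rewrite -{}kE //= => m; exists s.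
apply: push_iso2 j2.
  by move=> k [[i|g]|g] [j|h] + kE; rewrite -{}kE //= => m;
    [exists (inl i)|exists (inr g)].
by move=> [[i|g]|g] k' [j|h] + kE; rewrite -{}kE //= => m;
    [exists (inl i)|exists (inr g)].
Qed.

(** Multiplying the roots and the prunes of a quadruple does not depend on
    representatives. *)
Lemma merge_iso
    (U1 : lforest d M1 (tags2 Y1 Y2)) (U2 : lforest d M2 (tags2 Y1 Y2))
    (U1' : lforest d M1' (tags2 Y1' Y2')) (U2' : lforest d M2' (tags2 Y1' Y2')) :
  quad_iso U1 U2 U1' U2' ->
  coupled_iso (push (@tag_merge _ _ _ _ Y1 Y2) (product U1 U2))
    (push (@tag_merge _ _ _ _ Y1' Y2') (product U1' U2')).
Proof.
move=> [f1 [f2 [g1 [g2 [i1 i2 j1 j2]]]]].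
exists (sum_map f1 f2), (sum_map g1 g2); split; first exact: product_iso.
have [b1 _ _ _ _] := i1; have [b2 _ _ _ _] := i2.
have sI := imset_inj (bij_inj (sum_map_bij b1 b2)).
apply: push_iso2 (product_iso j1 j2).
  move=> k [i|k'] [[i'|g]|g] + kE; rewrite -{}kE //= => m.
  - by exists (inl (inl i)).
  - have [g' gE] := hedge_map g i1; exists (inl (inr g')) => //=.
    by congr inr; apply: val_inj; rewrite /= gE m imset_sum_inl.
  have [g' gE] := hedge_map g i2; exists (inr g') => //=.
  by congr inr; apply: val_inj; rewrite /= gE m imset_sum_inr.
move=> [i|k] k' [[i'|g]|g] + kE; rewrite -{}kE //= => m.
- by exists (inl (inl i)).
- have [g' gE] := hedge_map_inv g i1; exists (inl (inr g')) => //=.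
  by congr inr; apply/val_inj/sI; rewrite -m gE imset_sum_inl.
have [g' gE] := hedge_map_inv g i2; exists (inr g') => //=.
by congr inr; apply/val_inj/sI; rewrite -m gE imset_sum_inr.
Qed.

End Merge.

(** The composite of the twist and the product of quadruples, computed on
    arbitrary node sets. *)
Lemma quad_product_twist (N1 N2 M1 M2 : finType)
    (Y1 : lforest d N1 I) (Y2 : lforest d N2 I)
    (U1 : lforest d M1 (I + hedge Y1)) (U2 : lforest d M2 (I + hedge Y2)) :
  quad_product (twist (coupled_class U1, coupled_class U2))
  = coupled_class (push (@tag_merge _ _ _ _ Y1 Y2)
      (product (push (@tag_inc1 _ _ _ _ Y1 Y2) U1)
               (push (@tag_inc2 _ _ _ _ Y1 Y2) U2))).
Proof.
apply/esym/coupled_class_eq/merge_iso.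
apply: (quad_iso_trans (twist_iso (repr_coupled_class U1) (repr_coupled_class U2))).
set q := twist _; have e : q = \pi_(quad d I) (repr q) by rewrite reprK.
by move: e; rewrite {1}/q /twist => /eqmodP/asboolP.
Qed.

End CoupledIso.

(** * Hyperedges as an equivalence relation *)

Section Blocks.
Variables (d : nat).

(** Two nodes lie in a common untagged hyperedge. As the untagged hyperedges
    are non-empty and disjoint, this relation determines them. *)
Definition same_block (N : finType) (J : Type) (T : lions_data d N J) (x y : N) :=
  [exists h in hedges T, (x \in h) && (y \in h)].

Lemma same_blockP (N : finType) (J : Type) (T : lions_data d N J) x y :
  reflect (exists h, [/\ h \in hedges T, x \in h & y \in h]) (same_block T x y).
Proof.
apply: (iffP exists_inP) => [[h hT /andP[xh yh]]|[h [hT xh yh]]]; exists h => //.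
by rewrite xh yh.
Qed.

Lemma same_block_sym (N : finType) (J : Type) (T : lions_data d N J) x y :
  same_block T x y = same_block T y x.
Proof. by rewrite /same_block; apply: eq_existsb => h; rewrite (andbC (x \in h)). Qed.

Lemma in_block (N : finType) (J : Type) (T : lforest d N J) h x y :
  h \in hedges T -> x \in h -> (y \in h) = same_block T x y.
Proof.
move=> hT xh; apply/idP/same_blockP => [yh|[k [kT xk yk]]]; first by exists h.
by rewrite (hedges_inj (laxioms T) hT kT xh xk).
Qed.

Lemma imset_bij_eq (N N' : finType) (f : N -> N') (A : {set N}) (B : {set N'}) :
  bijective f -> (forall x, (f x \in B) = (x \in A)) -> B = f @: A.
Proof.
move=> bf fAB; have [g fK gK] := bf; apply/setP=> y; rewrite -(gK y) fAB.
by rewrite mem_imset //; apply: bij_inj.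
Qed.

(** An isomorphism need only preserve the relation of lying in a common
    hyperedge, not the set of hyperedges. *)
Lemma block_iso (N N' : finType) (J J' : Type) (m : J -> J' -> Prop)
    (T : lforest d N J) (T' : lforest d N' J') phi :
  bijective phi ->
  (forall x y, ((phi x, phi y) \in edges T') = ((x, y) \in edges T)) ->
  (forall x, lab T' (phi x) = lab T x) ->
  (forall j j' x, m j j' -> (phi x \in tags T' j') = (x \in tags T j)) ->
  (forall x y, same_block T' (phi x) (phi y) = same_block T x y) ->
  lions_iso m T T' phi.
Proof.
move=> bphi eE lE tE bE; split=> //.
  by move=> j j' jj'; apply: imset_bij_eq => // x; apply: tE.
have hE h h' x : h \in hedges T -> h' \in hedges T' -> x \in h -> phi x \in h' ->
    h' = phi @: h.
  move=> hT hT' xh xh'; apply: imset_bij_eq => // z.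
  by rewrite (in_block _ hT' xh') (in_block _ hT xh).
have [psi phiK psiK] := bphi.
apply/setP=> h'; apply/idP/imsetP=> [hT'|[h hT ->]].
  have /set0Pn[y yh'] := hedges_neq0 (laxioms T') hT'; rewrite -(psiK y) in yh'.
  have /same_blockP[h [hT xh _]] : same_block T (psi y) (psi y).
    by rewrite -bE -(in_block _ hT' yh').
  by exists h => //; apply: hE yh'.
have /set0Pn[x xh] := hedges_neq0 (laxioms T) hT.
have /same_blockP[k [kT xk _]] : same_block T' (phi x) (phi x).
  by rewrite bE -(in_block _ hT xh).
by rewrite -(hE h k x).
Qed.

Lemma iso_block (N N' : finType) (J J' : Type) (m : J -> J' -> Prop)
    (T : lions_data d N J) (T' : lions_data d N' J') phi x y :
  lions_iso m T T' phi -> same_block T' (phi x) (phi y) = same_block T x y.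
Proof.
move=> [b _ _ _ hE]; have I := bij_inj b.
apply/same_blockP/same_blockP=> -[h [hT xh yh]]; last first.
  exists (phi @: h); split; try by rewrite mem_imset.
  by rewrite hE; apply: (imset_f (fun k : {set N} => phi @: k)).
by move: hT xh yh; rewrite hE => /imsetP[k kT ->]; rewrite !mem_imset //; exists k.
Qed.

Lemma product_block (N1 N2 : finType) (J : Type) (T1 : lforest d N1 J)
    (T2 : lforest d N2 J) (x y : N1 + N2) :
  same_block (product T1 T2) x y =
  match x, y with
  | inl x, inl y => same_block T1 x y
  | inr x, inr y => same_block T2 x y
  | _, _ => false
  end.
Proof.
have I1 : injective (@inl N1 N2) by move=> ? ? [].
have I2 : injective (@inr N1 N2) by move=> ? ? [].
have lr (A : {set N1}) z : (inr z : N1 + N2) \in inl @: A = false.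
  by apply/negP=> /imsetP[].
have rl (A : {set N2}) z : (inl z : N1 + N2) \in inr @: A = false.
  by apply/negP=> /imsetP[].
apply/same_blockP/idP => [[h [/setUP[] /imsetP[k kT ->]]]|].
- case: x y => [x|x] [y|y]; rewrite ?lr ?(mem_imset _ _ I1) // => xk yk.
  by apply/same_blockP; exists k.
- case: x y => [x|x] [y|y]; rewrite ?rl ?(mem_imset _ _ I2) // => xk yk.
  by apply/same_blockP; exists k.
case: x y => [x|x] [y|y] // /same_blockP[k [kT xk yk]].
  by exists (inl @: k); rewrite !mem_imset //; split=> //; rewrite inE imset_f.
by exists (inr @: k); rewrite !mem_imset //; split=> //; rewrite inE imset_f ?orbT.
Qed.

Section CutBlocks.
Variables (N : finType) (J : Type) (T : lforest d N J) (c : cut T).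

Lemma cut_root_block (x y : {x | x \in root_nodes c}) :
  same_block (cut_root c) x y = same_block T (val x) (val y).
Proof.
apply/same_blockP/same_blockP => -[h []].
  by case/setD1P=> _ /imsetP[k kT ->]; rewrite !inE => xk yk; exists k.
move=> hT xh yh; exists (val @^-1: h); split; try by rewrite inE.
apply/setD1P; split; last exact: imset_f.
by apply/set0Pn; exists x; rewrite inE.
Qed.

Lemma cut_prune_block (x y : {x | x \in prune_nodes c}) :
  same_block (cut_prune c) x y = same_block T (val x) (val y) &&
    [forall z in root_nodes c, ~~ same_block T (val x) z].
Proof.
apply/same_blockP/andP => [[h []]|[/same_blockP[h [hT xh yh]] /forall_inP rx]].
  case/imsetP=> k; rewrite inE => /andP[kT /eqP k0] ->.
  rewrite !inE => xk yk; split; first by apply/same_blockP; exists k.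
  apply/forall_inP=> z zR; rewrite -(in_block _ kT xk); apply/negP=> zk.
  by move/setP/(_ z): k0; rewrite in_setI zk zR in_set0.
exists (restr (prune_nodes c) h); split; try by rewrite inE.
apply: imset_f; rewrite inE hT -subset0 /=; apply/subsetP=> z /setIP[zh zR].
by move: (rx _ zR); rewrite -(in_block _ hT xh) zh.
Qed.

Lemma cut_prune_tag (x : {x | x \in prune_nodes c}) (g : hedge (cut_root c)) :
  (x \in tags (cut_prune c) (inr g)) =
  [exists y in val g, same_block T (val x) (val y)].
Proof.
have /setD1P[/set0Pn[z zg] /imsetP[k kT gE]] := valP g.
have zk : val z \in k by move: zg; rewrite gE inE.
apply/bigcupP/exists_inP => [[h /andP[hT /eqP hg]]|[y yg]].
  rewrite inE => xh; exists z => //; rewrite -(in_block _ hT xh).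
  by move: zg; rewrite -hg inE.
rewrite same_block_sym => xy; have yk : val y \in k by move: yg; rewrite gE inE.
exists k; last by rewrite inE (in_block _ kT yk).
by rewrite kT; apply/eqP; rewrite gE; apply/setP=> w; rewrite !inE.
Qed.

End CutBlocks.

Lemma inj_surj_bij (A B : finType) (f : A -> B) :
  injective f -> (forall y, exists x, f x == y) -> bijective f.
Proof.
move=> fI fS; exists (fun y => xchoose (fS y)) => [x|y].
  exact/fI/eqP/(xchooseP (fS (f x))).
exact/eqP/(xchooseP (fS y)).
Qed.

Lemma embed_bij (A B : finType) (D : {set B}) (f : A -> B) (fD : forall x, f x \in D) :
  injective f -> (forall y, y \in D -> exists x, y = f x) ->
  bijective (fun x => exist (fun y => y \in D) (f x) (fD x)).
Proof.
move=> fI fS; apply: inj_surj_bij => [x y [/fI]|[y yD]] //.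
by have [x yx] := fS y yD; exists x; apply/eqP/val_inj.
Qed.

(** Recognition of the root and prune of a cut: the nodes of [Y] embed onto the
    root nodes by [f] and those of [U] onto the prune nodes by [g], compatibly
    with edges, labels, tags and common hyperedges. A node of [U] carries the
    tag of a hyperedge [h] of [Y] when it shares a hyperedge of [T] with [h];
    two nodes share a hyperedge of [U] when they share one of [T] that contains
    no root node. *)
Lemma cut_coupled_iso (I : Type) (N NR NP : finType) (T : lforest d N I) (c : cut T)
    (Y : lforest d NR I) (U : lforest d NP (I + hedge Y)) (f : NR -> N) (g : NP -> N) :
  injective f -> (forall x, f x \in root_nodes c) ->
  (forall y, y \in root_nodes c -> exists x, y = f x) ->
  injective g -> (forall x, g x \in prune_nodes c) ->
  (forall y, y \in prune_nodes c -> exists x, y = g x) ->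
  (forall x y, ((f x, f y) \in edges T) = ((x, y) \in edges Y)) ->
  (forall x, lab T (f x) = lab Y x) ->
  (forall i x, (f x \in tags T i) = (x \in tags Y i)) ->
  (forall x y, same_block T (f x) (f y) = same_block Y x y) ->
  (forall x y, ((g x, g y) \in edges T) = ((x, y) \in edges U)) ->
  (forall x, lab T (g x) = lab U x) ->
  (forall i x, (g x \in tags T i) = (x \in tags U (inl i))) ->
  (forall (h : hedge Y) x, [exists y in val h, same_block T (g x) (f y)]
     = (x \in tags U (inr h))) ->
  (forall x y, same_block T (g x) (g y) && [forall z, ~~ same_block T (g x) (f z)]
     = same_block U x y) ->
  coupled_iso U (cut_prune c).
Proof.
move=> fI fD fS gI gD gS fE fL fT fB gE gL gT gH gB.
have bf := embed_bij fD fI fS; have bg := embed_bij gD gI gS.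
exists (fun x => exist _ (f x) (fD x)), (fun x => exist _ (g x) (gD x)); split.
  apply: block_iso => //= [x y|i _ x <-|x y]; rewrite ?cut_root_block //=.
    by rewrite inE /= fE.
  by rewrite inE /= fT.
apply: block_iso => //= [x y|[i|h] [i'|h'] x //=|x y].
- by rewrite inE /= gE.
- by move=> <-; rewrite inE /= gT.
- move=> hE; rewrite -gH; apply: etrans (cut_prune_tag _ h') _ => /=.
  apply/exists_inP/exists_inP=> -[y yh xy].
    by move: yh xy; rewrite [val h']hE => /imsetP[z zh ->] xz; exists z.
  by exists (exist _ (f y) (fD y)); rewrite // [val h']hE imset_f.
rewrite -gB cut_prune_block; congr (_ && _).
apply/forall_inP/forallP=> [H z|H z /fS[w ->]]; last exact: H.
exact: H.
Qed.

End Blocks.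

(** * Cuts under isomorphisms and products *)

Lemma push_tags (d : nat) (N : finType) (J K : Type) (f : J -> K)
    (T : lforest d N J) j x : injective f ->
  (x \in tags (push f T) (f j)) = (x \in tags T j).
Proof.
by move=> fI; rewrite inE; apply/asboolP/idP => [[j' /fI->]|xj] //; exists j.
Qed.

Lemma push_block (d : nat) (N : finType) (J K : Type) (f : J -> K)
    (T : lforest d N J) x y : same_block (push f T) x y = same_block T x y.
Proof. by []. Qed.

Lemma push_tags_out (d : nat) (N : finType) (J K : Type) (f : J -> K)
    (T : lforest d N J) k x : (forall j, f j <> k) ->
  (x \in tags (push f T) k) = false.
Proof. by move=> fk; rewrite inE; apply/asboolP=> -[j /fk]. Qed.

Section CutIso.
Variables (d : nat) (I : Type).

Lemma up_closed_iso (N N' : finType) (T : lforest d N I) (T' : lforest d N' I) phi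
    (D : {set N}) :
  lions_iso eq T T' phi -> up_closed (edges T') (phi @: D) = up_closed (edges T) D.
Proof.
move=> [b eE _ _ _]; have inj := bij_inj b; have [psi _ psiK] := b.
apply/up_closedP/up_closedP=> cD x y.
  by rewrite -eE => /cD; rewrite !mem_imset.
by rewrite -(psiK x) -(psiK y) eE !mem_imset //; apply: cD.
Qed.

(** Cuts that correspond under an isomorphism have isomorphic coupled pairs. *)
Lemma cut_iso (N N' : finType) (T : lforest d N I) (T' : lforest d N' I) phi
    (c : cut T) (c' : cut T') :
  lions_iso eq T T' phi -> root_nodes c' = phi @: root_nodes c ->
  coupled_iso (cut_prune c) (cut_prune c').
Proof.
move=> i rE; have [b eE lE tE _] := i; have inj := bij_inj b; have [psi _ psiK] := b.
have pE x : (phi x \in prune_nodes c') = (x \in prune_nodes c).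
  by rewrite !in_setC rE mem_imset.
apply: (cut_coupled_iso (f := phi \o val) (g := phi \o val)) => /=.
- exact: inj_comp inj val_inj.
- by move=> x; rewrite rE mem_imset //; apply: (valP x).
- by rewrite rE => y /imsetP[x xR ->]; exists (exist _ x xR).
- exact: inj_comp inj val_inj.
- by move=> x; rewrite pE; apply: (valP x).
- by move=> y; rewrite -(psiK y) pE => yP; exists (exist _ (psi y) yP).
- by move=> x y; rewrite eE inE.
- by move=> x; rewrite lE.
- by move=> j x; rewrite (tE j j) // mem_imset // inE.
- by move=> x y; rewrite cut_root_block (iso_block _ _ i).
- by move=> x y; rewrite eE inE.
- by move=> x; rewrite lE.
- by move=> j x; rewrite (tE j j) // mem_imset // inE.
- move=> h x; rewrite cut_prune_tag; apply: eq_existsb => y.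
  by rewrite (iso_block _ _ i).
move=> x y; rewrite cut_prune_block (iso_block _ _ i); congr (_ && _).
apply/forallP/forall_inP=> H z; last by rewrite (iso_block _ _ i); apply/H/valP.
by move=> zR; move: (H (exist _ z zR)); rewrite (iso_block _ _ i).
Qed.

Section ProductSets.
Variables (N1 N2 : finType) (T1 : lforest d N1 I) (T2 : lforest d N2 I).

(** A set of nodes of a disjoint union, given by its two parts. *)
Definition sum_set (D : {set N1} * {set N2}) : {set N1 + N2} :=
  inl @: D.1 :|: inr @: D.2.

(** The two parts of a set of nodes of a disjoint union. *)
Definition sum_split (D : {set N1 + N2}) : {set N1} * {set N2} :=
  (inl @^-1: D, inr @^-1: D).

Lemma in_sum_set D x : (x \in sum_set D) =
  match x with inl x => x \in D.1 | inr x => x \in D.2 end.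
Proof.
rewrite in_setU; case: x => x; rewrite mem_imset; try by move=> ? ? [].
  by rewrite [X in _ || X](_ : _ = false) ?orbF //; apply/negP=> /imsetP[].
by rewrite [X in X || _](_ : _ = false) //; apply/negP=> /imsetP[].
Qed.

Lemma sum_setK : cancel sum_set sum_split.
Proof.
by case=> D1 D2; congr (_, _); apply/setP=> x; rewrite inE in_sum_set.
Qed.

Lemma sum_splitK : cancel sum_split sum_set.
Proof.
by move=> D; apply/setP=> x; rewrite in_sum_set; case: x => x; rewrite inE.
Qed.

Lemma up_closed_product D : up_closed (edges (product T1 T2)) (sum_set D)
  = up_closed (edges T1) D.1 && up_closed (edges T2) D.2.
Proof.
apply/up_closedP/andP => [cD|[/up_closedP c1 /up_closedP c2] x y].
  split; apply/up_closedP=> x y xy.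
    by move: (cD (inl x) (inl y)); rewrite inE !in_sum_set; apply.
  by move: (cD (inr x) (inr y)); rewrite inE !in_sum_set; apply.
by case: x y => [x|x] [y|y]; rewrite inE !in_sum_set //; [apply: c1|apply: c2].
Qed.

Lemma product_tags (J : Type) (U1 : lforest d N1 J) (U2 : lforest d N2 J) j x :
  (x \in tags (product U1 U2) j) =
  match x with inl x => x \in tags U1 j | inr x => x \in tags U2 j end.
Proof. exact: (in_sum_set (tags U1 j, tags U2 j)). Qed.

Lemma tag_inc1_inj : injective (@tag_inc1 _ _ _ _ T1 T2).
Proof. by move=> t t' []. Qed.

Lemma tag_inc2_inj : injective (@tag_inc2 _ _ _ _ T1 T2).
Proof. by move=> [i|h] [i'|h'] //= [->]. Qed.

Lemma tag_merge_inj : injective (@tag_merge _ _ _ _ T1 T2).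
Proof.
have lr (g : hedge T1) (g' : hedge T2) :
    (inl @: val g : {set N1 + N2}) <> inr @: val g'.
  have /set0Pn[x xg] := hedges_neq0 (laxioms T1) (valP g).
  by move/setP/(_ (inl x)); rewrite imset_f // => /esym/imsetP[].
move=> [[i|g]|g] [[i'|g']|g'] //= => [[->]//|[e]|[e]|[e]|[e]].
- by do 2 congr (_ _); apply/val_inj/(imset_inj _ e) => ? ? [].
- by case: (lr _ _ e).
- by case: (lr _ _ (esym e)).
by congr (_ _); apply/val_inj/(imset_inj _ e) => ? ? [].
Qed.

(** The tags given by the hyperedges of a product come from the hyperedges of
    its factors. *)
Lemma hedge_product (h : hedge (product T1 T2)) :
  (exists h1 : hedge T1, inr h = tag_merge (inl (inr h1)) /\ val h = inl @: val h1) \/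
  (exists h2 : hedge T2, inr h = tag_merge (inr h2) /\ val h = inr @: val h2).
Proof.
have /setUP[] := valP h => /imsetP[k kT hE]; [left|right].
  exists (exist (fun h => h \in hedges T1) k kT); split=> //.
  by congr inr; apply: val_inj.
exists (exist (fun h => h \in hedges T2) k kT); split=> //.
by congr inr; apply: val_inj.
Qed.

End ProductSets.

Section ProductCut.
Variables (N1 N2 : finType) (T1 : lforest d N1 I) (T2 : lforest d N2 I).
Variables (c : cut (product T1 T2)) (c1 : cut T1) (c2 : cut T2).
Hypothesis cE : root_nodes c = sum_set (root_nodes c1, root_nodes c2).

(** The twisted product of the coupled pairs of [c1] and [c2] is the coupled pair
    of the corresponding cut of the product. *)
Lemma product_cut_iso :
  coupled_iso
    (push (@tag_merge _ _ _ _ (cut_root c1) (cut_root c2))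
      (product (push (@tag_inc1 _ _ _ _ (cut_root c1) (cut_root c2)) (cut_prune c1))
               (push (@tag_inc2 _ _ _ _ (cut_root c1) (cut_root c2)) (cut_prune c2))))
    (cut_prune c).
Proof.
have pE x : (x \in prune_nodes c) =
    match x with inl x => x \in prune_nodes c1 | inr x => x \in prune_nodes c2 end.
  by rewrite in_setC cE in_sum_set; case: x => x; rewrite in_setC.
have vI (A : {set N1}) (B : {set N2}) :
  injective (sum_map (val : {x | x \in A} -> N1) (val : {x | x \in B} -> N2)).
  by move=> [x|x] [y|y] //= [/val_inj->].
apply: (cut_coupled_iso (f := sum_map val val) (g := sum_map val val)).
- exact: vI.
- by move=> [x|x]; rewrite cE in_sum_set; apply: (valP x).
- by move=> [y|y]; rewrite cE in_sum_set /= => yR;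
    [exists (inl (exist _ y yR)) | exists (inr (exist _ y yR))].
- exact: vI.
- by move=> [x|x]; rewrite pE; apply: (valP x).
- by move=> [y|y]; rewrite pE => yP;
    [exists (inl (exist _ y yP)) | exists (inr (exist _ y yP))].
- by move=> [x|x] [y|y]; rewrite !inE.
- by case.
- move=> i x; rewrite !product_tags.
  by case: x => x; rewrite inE.
- move=> x y; rewrite !product_block.
  by case: x y => [x|x] [y|y]; rewrite //= cut_root_block.
- by move=> [x|x] [y|y]; rewrite !inE.
- by case.
- move=> i x; rewrite product_tags.
  rewrite -[inl i]/(tag_merge (inl (inl i))) (push_tags _ _ _ (@tag_merge_inj _ _ _ _)).
  rewrite product_tags; case: x => x.
    rewrite -[inl (inl i)]/(tag_inc1 (cut_root c2) (inl i))
    (push_tags _ _ _ (@tag_inc1_inj _ _ _ _)).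
    by rewrite inE.
  rewrite -[inl (inl i)]/(tag_inc2 (cut_root c1) (inl i))
    (push_tags _ _ _ (@tag_inc2_inj _ _ _ _)).
  by rewrite inE.
- move=> h x; have [[h1 [-> hE]]|[h2 [-> hE]]] := hedge_product h.
    rewrite hE (push_tags _ _ _ (@tag_merge_inj _ _ _ _)) product_tags.
    case: x => x.
      rewrite -[inl (inr h1)]/(tag_inc1 (cut_root c2) (inr h1))
        (push_tags _ _ _ (@tag_inc1_inj _ _ _ _)).
      rewrite cut_prune_tag; apply/exists_inP/exists_inP => -[y yh].
        by move/imsetP: yh => [z zh ->]; rewrite product_block; exists z.
      by move=> xy; exists (inl y); rewrite ?imset_f ?product_block.
    (* nodes of the other part do not carry this tag *)
    rewrite push_tags_out; last by case.
    apply/exists_inP=> -[y /imsetP[z zh ->]].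
    by rewrite product_block.
  rewrite hE (push_tags _ _ _ (@tag_merge_inj _ _ _ _)) product_tags.
  case: x => x; last first.
    rewrite -[inr h2]/(tag_inc2 (cut_root c1) (inr h2))
      (push_tags _ _ _ (@tag_inc2_inj _ _ _ _)).
    rewrite cut_prune_tag; apply/exists_inP/exists_inP => -[y yh].
      by move/imsetP: yh => [z zh ->]; rewrite product_block; exists z.
    by move=> xy; exists (inr y); rewrite ?imset_f ?product_block.
  rewrite push_tags_out; last by case.
  apply/exists_inP=> -[y /imsetP[z zh ->]].
  by rewrite product_block.
move=> x y; rewrite push_block !product_block; case: x y => [x|x] [y|y] //=.
  rewrite push_block cut_prune_block; congr (_ && _).
  apply/forallP/forall_inP=> H z.
    by move=> zR; move: (H (inl (exist _ z zR))); rewrite product_block.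
  by case: z => z; rewrite product_block //; apply/H/valP.
rewrite push_block cut_prune_block; congr (_ && _).
apply/forallP/forall_inP=> H z.
  by move=> zR; move: (H (inr (exist _ z zR))); rewrite product_block.
by case: z => z; rewrite product_block //; apply/H/valP.
Qed.

End ProductCut.
End CutIso.

(** * The coproduct and counit of a product *)

Section Bialgebra.
Variables (d : nat) (I : Type) (R : pzRingType).
Local Notation F := (forests d I).
Local Notation FF := (coupled d I).

(** The coproduct of a forest given on an arbitrary node set. *)
Definition cut_sum (N : finType) (T : lforest d N I) : fspan R FF :=
  \sum_(c : cut T) gen (coupled_class (cut_prune c)).

Lemma cut_sum_iso (N N' : finType) (T : lforest d N I) (T' : lforest d N' I) phi :
  lions_iso eq T T' phi -> cut_sum T = cut_sum T'.
Proof.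
move=> i; have [b _ _ _ _] := i; have [psi phiK psiK] := b.
rewrite /cut_sum !big_cut [RHS](reindex (fun D : {set N} => phi @: D)) /=; last first.
  apply: onW_bij; exists (fun D : {set N'} => psi @: D) => D;
    rewrite -imset_comp -[RHS]imset_idE; apply: eq_imset => x;
    [exact: phiK|exact: psiK].
apply: eq_big => [D|D cD]; first by rewrite (up_closed_iso D i).
congr gen; apply/coupled_class_eq/(cut_iso i).
by rewrite !root_nodes_cut_of ?(up_closed_iso D i).
Qed.

Lemma cut_sum_product (N1 N2 : finType) (T1 : lforest d N1 I) (T2 : lforest d N2 I) :
  cut_sum (product T1 T2) = \sum_(c1 : cut T1) \sum_(c2 : cut T2)
    gen (quad_product
      (twist (coupled_class (cut_prune c1), coupled_class (cut_prune c2)))).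
Proof.
rewrite /cut_sum big_cut (reindex (@sum_set N1 N2)) /=; last first.
  by apply: onW_bij; exists (@sum_split N1 N2); [apply: sum_setK|apply: sum_splitK].
rewrite [RHS]big_cut; under [RHS]eq_bigr do rewrite big_cut.
rewrite pair_big /=; apply: eq_big => [D|D];
  rewrite up_closed_product // => /andP[c1 c2].
congr gen; rewrite quad_product_twist; apply/esym/coupled_class_eq/product_cut_iso.
by rewrite !root_nodes_cut_of ?up_closed_product ?c1 //; case: (D).
Qed.

Lemma Delta_class (N : finType) (T : lforest d N I) :
  Delta d I R (gen (forest_class T)) = cut_sum T.
Proof.
rewrite /Delta lin_gen; have [phi i] := repr_forest_class T.
exact/esym/(cut_sum_iso i).
Qed.

Lemma cut_sum_empty : cut_sum (empty_forest d I) = gen (one_coupled d I).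
Proof.
have D0 (D : {set void}) : D = set0 by apply/setP=> -[].
rewrite /cut_sum big_cut (big_pred1 set0) => [|D]; last first.
  by rewrite (D0 D) /= eqxx; apply/up_closedP=> -[].
congr gen; apply: coupled_class_eq.
have v0 (A : {set void}) (x : {x | x \in A}) : False by case: (val x).
have [phi i] := empty_iso eq (cut_root (cut_of (empty_forest d I) set0))
  (empty_forest d I) (@v0 _) (of_void _).
have [psi j] := empty_iso (@tag_match _ _ _ _ _ _ phi)
  (cut_prune (cut_of (empty_forest d I) set0))
  (empty_forest d (I + hedge (empty_forest d I))) (@v0 _) (of_void _).
by exists phi, psi.
Qed.

Lemma forest_class_one (N : finType) (T : lforest d N I) :
  (forest_class T == one_forest d I) = (#|N| == 0)%N.
Proof.
apply/eqP/eqP=> [|N0].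
  move=> /eqmodP/asboolP[phi [b _ _ _ _]].
  by have := bij_eq_card b; rewrite !card_ord /= => ->; apply: card_void.
have NF (x : N) : False by have := fintype0 x N0.
have [phi i] := empty_iso eq T (empty_forest d I) NF (of_void _).
exact: forest_class_eq i.
Qed.

Lemma forest_product_one (t1 t2 : F) :
  (forest_product t1 t2 == one_forest d I)
  = (t1 == one_forest d I) && (t2 == one_forest d I).
Proof.
rewrite -{2}(forest_class_repr t1) -{2}(forest_class_repr t2) !forest_class_one.
by rewrite card_sum addn_eq0.
Qed.

End Bialgebra.

Theorem theorem4p27 (d : nat) (I : Type) (R : pzRingType) :
  [/\ Delta d I R \o prod_map d I R =1
        coupled_prod_map d I R \o Twist d I R \o Delta_Delta d I R,
      counit d I R \o prod_map d I R =1 mul_counit_counit d I R,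
      forall r s : R, Delta d I R (unit_map d I (r * s)) = unit_unit d I r s
    & counit d I R \o unit_map d I =1 id].
Proof.
split=> [u|u|r s|r] /=.
- rewrite {1}/Delta /prod_map lin_lin /Twist /coupled_prod_map /Delta_Delta.
  rewrite /lin2 !lin_lin.
  (* all maps are linear extensions: it suffices to compare generators *)
  apply: eq_lin => -[t1 t2]; rewrite -/(Delta d I R _) /=.
  rewrite Delta_class cut_sum_product /Delta !lin_gen tensor_sum !lin_sum.
  apply: eq_bigr => c1 _; rewrite !lin_sum; apply: eq_bigr => c2 _.
  by rewrite !lin_gen.
- rewrite /counit /prod_map lin_lin /mul_counit_counit /lin2.
  apply: (@eq_lin R _ R^o) => -[t1 t2] /=.
  rewrite /counit !lin_gen /= forest_product_one.
  by case: (t1 == _); case: (t2 == _); rewrite /= ?mulr0 ?mul0r ?mulr1.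
- by rewrite /unit_map {1}/Delta linZ -/(Delta d I R _) Delta_class cut_sum_empty.
by rewrite /counit /unit_map linZ lin_gen eqxx; apply: mulr1.
Qed.
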